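(* The action of $H_{B'}(\mathscr W_{\mathfrak O})/H_{B'}(\mathscr W_{\mathfrak m})$ on $V_\psi$ (induced by $\Pi'_\Psi$) realizes the Heisenberg representation of $H_\beta(W)$ attached to the central character $\psi$.
   Context: $K/\mathbb Q_2$ is an unramified field extension of degree $d$, $\mathfrak O$ its ring of integers, $\mathfrak m^n=2^n\mathfrak O$, $F=\mathfrak O/\mathfrak m$, $R=\mathfrak O/\mathfrak m^2$. $(\mathscr W,\langle,\rangle)$ is a symplectic $K$-space of dimension $2m$ with symplectic basis $e_1,\dots,e_m,e_1^*,\dots,e_m^*$, $\mathcal X=\mathrm{Span}_K\{e_i\}$, $\mathcal X^*=\mathrm{Span}_K\{e_i^*\}$; for $x,y\in\mathcal X$, $x^*,y^*\in\mathcal X^*$, $B(x+x^*,y+y^* )=\langle x,y^*\rangle$ and $B'=2B$. $H_{B'}(\mathscr W)=\mathscr W\times K$ with law $(w,t)+(w',t')=(w+w',t+t'+B'(w,w'))$. $\Psi$ is a character of $K$ of level $\mathfrak m^2$ (trivial on $\mathfrak m^2$, non-trivial on $\mathfrak m$); its restriction to $\mathfrak O$ defines a character of $R$, denoted $\psi$, and $\Psi$ is moreover chosen such that $\psi$ is a faithful representation of $R$. $\mathcal L'=\mathrm{Span}_{\mathfrak O}\{2e_i,e_i^*\}$. $S_{\mathcal L'}$ is the space of locally constant compactly supported $f:\mathscr W\to\mathbb C$ with $f(l+w)=\Psi(-B'(l,w))f(w)$ for $l\in\mathcal L'$, $w\in\mathscr W$; $H_{B'}(\mathscr W)$ acts on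 it by $\Pi'_\Psi(w',t)f(w)=\Psi(t+B'(w,w'))f(w+w')$. Let $\mathcal L'^{\frac12}=\mathrm{Span}_{\mathfrak O}\{e_i,e_i^*\}$ and let $V_\psi\subset S_{\mathcal L'}$ be the subspace of functions supported on $\mathcal L'^{\frac12}$. Put $\mathscr W_{\mathfrak O}=\mathcal L'^{\frac12}$, $\mathscr W_{\mathfrak m}=2\mathscr W_{\mathfrak O}$, $H_{B'}(\mathscr W_{\mathfrak O})=\mathscr W_{\mathfrak O}\times\mathfrak O$ and $H_{B'}(\mathscr W_{\mathfrak m})=\mathscr W_{\mathfrak m}\times\mathfrak m^2$, subgroups of $H_{B'}(\mathscr W)$; $H_{B'}(\mathscr W_{\mathfrak m})$ is normal in $H_{B'}(\mathscr W_{\mathfrak O})$, $V_\psi$ is $H_{B'}(\mathscr W_{\mathfrak O})$-stable, and $H_{B'}(\mathscr W_{\mathfrak m})$ acts trivially on $V_\psi$. $W=\mathscr W_{\mathfrak O}/\mathscr W_{\mathfrak m}$ (an $F$-space of dimension $2m$), $\beta:W\times W\to R$, $\beta(\overline w,\overline w')=2B(w,w')\bmod\mathfrak m^2$, and $H_\beta(W)=W\times R$ with law $(w,t)+(w',t')=(w+w',t+t'+\beta(w,w'))$. The quotient $H_{B'}(\mathscr W_{\mathfrak O})/H_{B'}(\mathscr W_{\mathfrak m})$ is identified with $H_\beta(W)$ by $[w,t]\mapsto[\overline w,\overline t]$. For a faithful character $\psi$ of $R$, the Heisenberg representation of $H_\beta(W)$ attached to $\psi$ is the unique (up to isomorphism)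 irreducible representation of $H_\beta(W)$ with central character $\psi$. *)

(* Defs.v *)
From HB Require Import structures.
From mathcomp Require Import all_boot all_order all_algebra all_field.
From mathcomp Require Import generic_quotient ring_quotient sesquilinear.
From mathcomp Require Import all_classical all_reals.
From mathcomp Require Import topology.
From mathcomp Require Import complex.

Set Implicit Arguments.
Unset Strict Implicit.
Unset Printing Implicit Defensive.

Import Order.TTheory GRing.Theory Num.Theory.

Local Open Scope classical_set_scope.
Local Open Scope quotient_scope.
Local Open Scope ring_scope.

Definition abs2_rat (R : realType) (q : rat) : R :=
  if q == 0 then 0
  else 2 ^+ logn 2 `|denq q|%N / 2 ^+ logn 2 `|numq q|%N.

Record ultrametric_abs (R : realType) (k : fieldType) (abs : k -> R) : Prop := {
  abs_ge0 : forall x, 0 <= abs x;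
  abs_eq0 : forall x, abs x = 0 <-> x = 0;
  absM : forall x y, abs (x * y) = abs x * abs y;
  absD : forall x y, abs (x + y) <= Num.max (abs x) (abs y)
}.

(* Q_2 is given up to isometric isomorphism: a completion of the rationals for
   the 2-adic absolute value. *)
Record Q2_field (R : realType) := {
  Q2_sort :> fieldType;
  Q2_abs : Q2_sort -> R;
  Q2_absP : ultrametric_abs Q2_abs;
  Q2_abs_rat : forall q : rat, Q2_abs (ratr q) = abs2_rat R q;
  Q2_dense : forall (x : Q2_sort) (eps : R), 0 < eps ->
    exists q : rat, Q2_abs (x - ratr q) < eps;
  Q2_complete : forall u : nat -> Q2_sort,
    (forall eps : R, 0 < eps -> exists N : nat, forall i j : nat,
       (N <= i)%N -> (N <= j)%N -> Q2_abs (u i - u j) < eps) ->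
    exists l : Q2_sort, forall eps : R, 0 < eps -> exists N : nat,
      forall n : nat, (N <= n)%N -> Q2_abs (u n - l) < eps
}.

(* An extension of degree d comes with the unique absolute value extending that
   of Q_2; it is unramified when its ramification index [|K^*| : |Q_2^*|] is 1
   (the residue extension is automatically separable). *)
Record unramified_ext (R : realType) (Q : Q2_field R) (d : nat) := {
  ue_sort :> fieldExtType Q;
  ue_abs : ue_sort -> R;
  ue_degree : \dim {: ue_sort} = d;
  ue_absP : ultrametric_abs ue_abs;
  ue_abs_ext : forall x : Q, ue_abs (x%:A : ue_sort) = Q2_abs x;
  ue_unramified : forall x : ue_sort, x != 0 ->
    exists y : Q, y != 0 /\ ue_abs x = Q2_abs y
}.

Section Integers.
Context {R : realType} {Q : Q2_field R} {d : nat} (K : unramified_ext Q d).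

Definition integers : {pred K} := [pred x | ue_abs x <= 1].

(* 2^n O *)
Definition mpow (n : nat) : {pred K} := [pred x | x / 2 ^+ n \in integers].

Lemma ue_abs0 : ue_abs (0 : K) = 0.
Proof. exact/(abs_eq0 (ue_absP K)). Qed.

Lemma ue_abs1 : ue_abs (1 : K) = 1.
Proof.
have n0 : ue_abs (1 : K) != 0.
  by apply/eqP => /(abs_eq0 (ue_absP K))/eqP; rewrite oner_eq0.
apply: (mulfI n0).
by rewrite -(absM (ue_absP K)) !mulr1.
Qed.

Lemma ue_absN (x : K) : ue_abs (- x) = ue_abs x.
Proof.
suff h : ue_abs (-1 : K) = 1.
  by rewrite -mulN1r (absM (ue_absP K)) h mul1r.
have := absM (ue_absP K) (-1) (-1).
rewrite mulrNN mulr1 ue_abs1 => /esym/eqP.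
rewrite -expr2 sqrf_eq1 => /orP[/eqP //|/eqP h].
by have := abs_ge0 (ue_absP K) (-1); rewrite h ler0N1.
Qed.

Lemma ue_abs2 : ue_abs (2 : K) = 2^-1.
Proof.
have -> : (2 : K) = (ratr 2%:Q : Q)%:A.
  by rewrite /ratr numq_int denq_int divr1 scaler_nat.
by rewrite ue_abs_ext Q2_abs_rat /abs2_rat /= mul1r.
Qed.

Lemma ue_two_neq0 : (2 : K) != 0.
Proof.
apply/eqP => h; have := ue_abs2; rewrite h ue_abs0 => /esym/eqP.
by rewrite invr_eq0 pnatr_eq0.
Qed.

Lemma integers_subring : subring_closed integers.
Proof.
split; rewrite ?inE /= ?ue_abs1 // => x y; rewrite !inE /= => hx hy.
  apply: le_trans (absD (ue_absP K) _ _) _.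
  by rewrite ge_max hx ue_absN hy.
by rewrite (absM (ue_absP K)) mulr_ile1 ?(abs_ge0 (ue_absP K)).
Qed.

HB.instance Definition _ :=
  GRing.isSubringClosed.Build K integers integers_subring.

Record int_type := IntElt { int_val : K; _ : int_val \in integers }.
HB.instance Definition _ := [isSub for int_val].
HB.instance Definition _ := [Choice of int_type by <:].
HB.instance Definition _ := [SubChoice_isSubComNzRing of int_type by <:].

Definition ideal_m2 : {pred int_type} := [pred x | val x \in mpow 2].

Lemma ideal_m2_closed : idealr_closed ideal_m2.
Proof.
split => [||a x y]; rewrite !inE /=.
- by rewrite mul0r ue_abs0 ler01.
- rewrite mul1r -[_ <= 1]/(_ \in integers); apply/negP; rewrite inE /= => h.
  have := absM (ue_absP K) (2 ^+ 2) (2 ^+ 2)^-1.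
  rewrite divff ?expf_neq0 ?ue_two_neq0 // ue_abs1 => e.
  have h4 : ue_abs (2 ^+ 2 : K) = 2^-1 ^+ 2.
    by rewrite expr2 (absM (ue_absP K)) ue_abs2 expr2.
  have : (1 : R) <= 2^-1 ^+ 2.
    by rewrite {1}e h4 ler_piMr // exprn_ge0 // invr_ge0.
  by rewrite leNgt exprn_ilt1 // ?invr_ge0 // invf_lt1 // ltr1n.
rewrite -![_ <= 1]/(_ \in integers) => hx hy.
rewrite mulrDl -mulrA rpredD // rpredM //.
exact: valP.
Qed.

HB.instance Definition _ :=
  isIdealr.Build int_type ideal_m2 ideal_m2_closed.

(* R = O / m^2 *)
Definition res_ring := {ideal_quot ideal_m2}.
HB.instance Definition _ := GRing.ComNzRing.on res_ring.
HB.instance Definition _ := EqQuotient.on res_ring.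
Definition to_res (x : int_type) : res_ring := \pi_res_ring x.
End Integers.
Arguments integers {R Q d} K.
Arguments mpow {R Q d} K n.
Arguments ideal_m2 {R Q d} K.

Record symplectic_space (k : fieldType) (m : nat) := {
  sp_space :> vectType k;
  sp_form : {biscalar sp_space};
  sp_alternating : forall w, sp_form w w = 0;
  sp_nondegenerate : forall w, (forall w', sp_form w w' = 0) -> w = 0;
  sp_e : m.-tuple sp_space;
  sp_es : m.-tuple sp_space;
  sp_basisP : basis_of {: sp_space} (sp_e ++ sp_es);
  sp_form_ee : forall i j, sp_form (tnth sp_e i) (tnth sp_e j) = 0;
  sp_form_eses : forall i j, sp_form (tnth sp_es i) (tnth sp_es j) = 0;
  sp_form_ees : forall i j, sp_form (tnth sp_e i) (tnth sp_es j) = (i == j)%:R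
}.

Section FormB.
Context {k : fieldType} {m : nat} (W : symplectic_space k m).

Definition sp_X : {vspace W} := <<sp_e W>>%VS.
Definition sp_Xs : {vspace W} := <<sp_es W>>%VS.
Definition sp_basis : (m + m).-tuple W := [tuple of sp_e W ++ sp_es W].

(* B(x + x', y + y') = <x, y'> for x, y in X and x', y' in X^* *)
Definition formB (w w' : W) : k :=
  sp_form W (daddv_pi sp_X sp_Xs w) (daddv_pi sp_Xs sp_X w').
Definition formB' (w w' : W) : k := 2 * formB w w'.

Lemma formBDl (w1 w2 w : W) : formB (w1 + w2) w = formB w1 w + formB w2 w.
Proof. by rewrite /formB linearD linearDl. Qed.
Lemma formBDr (w w1 w2 : W) : formB w (w1 + w2) = formB w w1 + formB w w2.
Proof. by rewrite /formB linearD linearDr. Qed.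
Lemma formBZl (a : k) (w w' : W) : formB (a *: w) w' = a * formB w w'.
Proof. by rewrite /formB linearZ /= linearZl_LR. Qed.
Lemma formBZr (a : k) (w w' : W) : formB w (a *: w') = a * formB w w'.
Proof. by rewrite /formB linearZ /= linearZr_LR. Qed.
Lemma formBNl (w w' : W) : formB (- w) w' = - formB w w'.
Proof. by rewrite -scaleN1r formBZl mulN1r. Qed.
Lemma formBNr (w w' : W) : formB w (- w') = - formB w w'.
Proof. by rewrite -scaleN1r formBZr mulN1r. Qed.
Lemma formB_suml (I : Type) (r : seq I) (F : I -> W) (w : W) :
  formB (\sum_(i <- r) F i) w = \sum_(i <- r) formB (F i) w.
Proof.
elim/big_ind2: _ => [||//]; last by move=> ? ? ? ? <- <-; rewrite formBDl.
by rewrite -(scale0r 0) formBZl mul0r.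
Qed.
Lemma formB_sumr (I : Type) (r : seq I) (F : I -> W) (w : W) :
  formB w (\sum_(i <- r) F i) = \sum_(i <- r) formB w (F i).
Proof.
elim/big_ind2: _ => [||//]; last by move=> ? ? ? ? <- <-; rewrite formBDr.
by rewrite -(scale0r 0) formBZr mul0r.
Qed.

Lemma sp_cap0 : (sp_X :&: sp_Xs = 0)%VS.
Proof.
have := basis_free (sp_basisP W).
by rewrite cat_free => /and3P[_ _ /directv_addP].
Qed.

Lemma formB_basis (i j : 'I_(m + m)) :
  formB (tnth sp_basis i) (tnth sp_basis j) =
    [exists a : 'I_m, (i == lshift m a) && (j == rshift m a)]%:R.
Proof.
have cap0 := sp_cap0; have cap0' : (sp_Xs :&: sp_X = 0)%VS by rewrite capvC.
have eX a : tnth (sp_e W) a \in sp_X by apply: memv_span; exact: mem_tnth.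
have esXs a : tnth (sp_es W) a \in sp_Xs by apply: memv_span; exact: mem_tnth.
have proj0 (U V : {vspace W}) v :
    (U :&: V = 0)%VS -> v \in V -> daddv_pi U V v = 0.
  move=> UV0 vV; apply/eqP; rewrite -memv0 -UV0 memv_cap memv_pi /=.
  have VU0 : (V :&: U = 0)%VS by rewrite capvC.
  have := daddv_pi_add UV0 (subvP (addvSr U V) _ vV).
  rewrite (daddv_pi_id VU0 vV) => /(canRL (addrK _)) ->.
  by rewrite subrr mem0v.
rewrite /formB /sp_basis.
case: (split_ordP i) => a ->; case: (split_ordP j) => b ->;
  rewrite ?tnth_lshift ?tnth_rshift.
- rewrite (proj0 sp_Xs) // linear0r; case: existsP => // -[c /andP[_]].
  by rewrite eq_lrshift.
- rewrite !daddv_pi_id // sp_form_ees; congr (_%:R); congr nat_of_bool.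
  apply/eqP/existsP => [->|[c /andP[/eqP/lshift_inj -> /eqP/rshift_inj ->]] //].
  by exists b; rewrite !eqxx.
- rewrite (proj0 sp_X) // linear0l; case: existsP => // -[c /andP[]].
  by rewrite eq_rlshift.
- rewrite (proj0 sp_X) // linear0l; case: existsP => // -[c /andP[]].
  by rewrite eq_rlshift.
Qed.
End FormB.

Section Lattices.
Context {R : realType} {Q : Q2_field R} {d : nat} {K : unramified_ext Q d}.
Context {m : nat} (W : symplectic_space K m).

Definition int_span n (b : n.-tuple W) : {pred W} :=
  [pred w | `[< exists a : 'I_n -> int_type K,
     w = \sum_(i < n) val (a i) *: tnth b i >]].

Lemma int_span_closed n (b : n.-tuple W) : zmod_closed (int_span b).
Proof.
split.
  rewrite inE; exists (fun=> 0).
  by rewrite big1 // => i _; rewrite raddf0 scale0r.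
move=> u v; rewrite !inE => -[a ->] [c ->].
exists (fun i => a i - c i).
by rewrite -sumrB; apply: eq_bigr => i _; rewrite raddfB scalerBl.
Qed.
HB.instance Definition _ n (b : n.-tuple W) :=
  GRing.isZmodClosed.Build W (int_span b) (int_span_closed b).

Definition lat_L' : {pred W} :=
  int_span [tuple of map_tuple ( *:%R 2) (sp_e W) ++ sp_es W].
(* L'^{1/2} = W_O *)
Definition lat_half : {pred W} := int_span (sp_basis W).
HB.instance Definition _ := GRing.ZmodClosed.on lat_half.

Record latO := LatO { latO_val : W; _ : latO_val \in lat_half }.
HB.instance Definition _ := [isSub for latO_val].
HB.instance Definition _ := [Choice of latO by <:].
HB.instance Definition _ := [SubChoice_isSubZmodule of latO by <:].

Definition lat_m : {pred latO} := [pred w | 2^-1 *: val w \in lat_half].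
Lemma lat_m_closed : zmod_closed lat_m.
Proof.
have E (w : latO) : (w \in lat_m) = (2^-1 *: val w \in lat_half) by [].
split=> [|u v]; rewrite !E ?raddf0 ?scaler0 ?rpred0 // => hu hv.
by rewrite (raddfB val) scalerBr rpredB.
Qed.
HB.instance Definition _ := GRing.isZmodClosed.Build latO lat_m lat_m_closed.

(* W = W_O / W_m *)
Definition resW := Quotient.quot lat_m.
HB.instance Definition _ := GRing.Zmodule.on resW.
HB.instance Definition _ := EqQuotient.on resW.
Definition to_resW (w : latO) : resW := \pi_resW w.

Lemma formB_int (w w' : latO) : formB (val w) (val w') \in integers K.
Proof.
case: w w' => [w hw] [w' hw'] /=.
move: hw hw'; rewrite !inE => -[a ->] [c ->].
rewrite formB_suml -[_ <= 1]/(_ \in integers K); apply: rpred_sum => i _.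
rewrite formB_sumr; apply: rpred_sum => j _.
rewrite formBZl formBZr formB_basis !rpredM ?rpred_nat //; exact: valP.
Qed.

Definition formBO (w w' : latO) : int_type K := IntElt (formB_int w w').
Definition formB'O (w w' : latO) : int_type K := 2 * formBO w w'.

Definition beta (u v : resW) : res_ring K := to_res (formB'O (repr u) (repr v)).

Lemma to_resD (x y : int_type K) : to_res (x + y) = to_res x + to_res y.
Proof. exact: raddfD. Qed.
Lemma to_resWD (u v : latO) : to_resW (u + v) = to_resW u + to_resW v.
Proof. exact: raddfD. Qed.
Lemma to_res_eq (x y : int_type K) :
  (to_res x == to_res y) = (val (x - y) \in mpow K 2).
Proof. by rewrite /to_res -Quotient.idealrBE. Qed.
Lemma to_resW_eq (u v : latO) :
  (to_resW u == to_resW v) = (2^-1 *: val (u - v) \in lat_half).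
Proof. by rewrite /to_resW -Quotient.idealrBE. Qed.
Lemma to_resK (r : res_ring K) : to_res (repr r) = r.
Proof. exact: reprK. Qed.
Lemma to_resWK (u : resW) : to_resW (repr u) = u.
Proof. exact: reprK. Qed.

Lemma val_formB'O (w w' : latO) : val (formB'O w w') = formB' (val w) (val w').
Proof. by rewrite (rmorphM val). Qed.

Lemma formB'ODl (u v w : latO) : formB'O (u + v) w = formB'O u w + formB'O v w.
Proof.
apply: val_inj; rewrite [RHS](raddfD val) !val_formB'O (raddfD val).
by rewrite /formB' formBDl mulrDr.
Qed.
Lemma formB'ODr (w u v : latO) : formB'O w (u + v) = formB'O w u + formB'O w v.
Proof.
apply: val_inj; rewrite [RHS](raddfD val) !val_formB'O (raddfD val).
by rewrite /formB' formBDr mulrDr.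
Qed.

Lemma betaE (w w' : latO) : beta (to_resW w) (to_resW w') = to_res (formB'O w w').
Proof.
rewrite /beta; set u := repr _; set u' := repr _.
have := eqxx (to_resW w); rewrite -{1}(to_resWK (to_resW w)) to_resW_eq -/u => hu.
have := eqxx (to_resW w'); rewrite -{1}(to_resWK (to_resW w')) to_resW_eq -/u' => hu'.
apply/eqP; rewrite to_res_eq.
have t0 := ue_two_neq0 K.
have E : val (formB'O u u' - formB'O w w') / 2 ^+ 2 =
    formB (2^-1 *: val (u - w)) (val u') + formB (val w) (2^-1 *: val (u' - w')).
  have -> : val (formB'O u u' - formB'O w w') =
      formB' (val u) (val u') - formB' (val w) (val w').
    by rewrite -!val_formB'O; exact: (raddfB val).
  have -> : val (u - w) = val u - val w by exact: (raddfB val).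
  have -> : val (u' - w') = val u' - val w' by exact: (raddfB val).
  rewrite formBZl formBZr -mulrDr /formB' -mulrBr expr2 invfM mulrACA divff //.
  rewrite mul1r mulrC; congr (_ * _).
  by rewrite formBDl formBDr formBNl formBNr addrA subrK.
rewrite -[_ \in _]/(_ / _ \in integers K) E.
by rewrite rpredD ?(formB_int (LatO hu)) ?(formB_int _ (LatO hu')).
Qed.

Lemma betaDl (u v w : resW) : beta (u + v) w = beta u w + beta v w.
Proof.
rewrite -(to_resWK u) -(to_resWK v) -(to_resWK w) -to_resWD !betaE.
by rewrite formB'ODl to_resD.
Qed.
Lemma betaDr (w u v : resW) : beta w (u + v) = beta w u + beta w v.
Proof.
rewrite -(to_resWK u) -(to_resWK v) -(to_resWK w) -to_resWD !betaE.
by rewrite formB'ODr to_resD.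
Qed.

End Lattices.
Arguments lat_L' {R Q d K m} W.
Arguments lat_half {R Q d K m} W.
Arguments lat_m {R Q d K m} W.

Record biadditive (A T : zmodType) := Biadditive {
  biadd_fun :> A -> A -> T;
  biaddDl : forall u v w, biadd_fun (u + v) w = biadd_fun u w + biadd_fun v w;
  biaddDr : forall w u v, biadd_fun w (u + v) = biadd_fun w u + biadd_fun w v
}.

(* A x T with the law (w, t)(w', t') = (w + w', t + t' + b(w, w')). *)
Record heis (A T : zmodType) (b : biadditive A T) :=
  Heis { heis_w : A; heis_t : T }.
Arguments Heis {A T b}.

Section HeisenbergGroup.
Context {A T : zmodType} {b : biadditive A T}.
Local Notation H := (heis b).

Lemma heis_pairK :
  cancel (fun h : H => (heis_w h, heis_t h)) (fun p => Heis p.1 p.2).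
Proof. by case. Qed.
HB.instance Definition _ := Choice.copy H (can_type heis_pairK).

Definition heis_mul (h h' : H) : H :=
  Heis (heis_w h + heis_w h') (heis_t h + heis_t h' + b (heis_w h) (heis_w h')).
Definition heis_one : H := Heis 0 0.
Definition heis_inv (h : H) : H :=
  Heis (- heis_w h) (- heis_t h + b (heis_w h) (heis_w h)).

Lemma biadd0l w : b 0 w = 0.
Proof. by apply: (addrI (b 0 w)); rewrite -biaddDl !addr0. Qed.
Lemma biadd0r w : b w 0 = 0.
Proof. by apply: (addrI (b w 0)); rewrite -biaddDr !addr0. Qed.
Lemma biaddNl u w : b (- u) w = - b u w.
Proof. by apply: (addrI (b u w)); rewrite -biaddDl !subrr biadd0l. Qed.
Lemma biaddNr w u : b w (- u) = - b w u.
Proof. by apply: (addrI (b w u)); rewrite -biaddDr !subrr biadd0r. Qed.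

Lemma heis_mulA : associative heis_mul.
Proof.
move=> [u r] [v s] [w t]; rewrite /heis_mul /=; congr Heis; first exact: addrA.
rewrite biaddDl biaddDr -!addrA; do 2![congr (_ + _)].
by rewrite [RHS]addrCA; congr (_ + _); rewrite [LHS]addrC -addrA.
Qed.
Lemma heis_mul1 : left_id heis_one heis_mul.
Proof. by case=> w t; rewrite /heis_mul /= !add0r biadd0l addr0. Qed.
Lemma heis_mulr1 : right_id heis_one heis_mul.
Proof. by case=> w t; rewrite /heis_mul /= !addr0 biadd0r addr0. Qed.
Lemma heis_mulV : left_inverse heis_one heis_inv heis_mul.
Proof.
case=> w t; rewrite /heis_mul /= addNr; congr Heis.
by rewrite biaddNl addrAC addrK addNr.
Qed.
Lemma heis_mulrV : right_inverse heis_one heis_inv heis_mul.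
Proof.
case=> w t; rewrite /heis_mul /= subrr; congr Heis.
by rewrite biaddNr addrA subrr add0r subrr.
Qed.
HB.instance Definition _ := isGroup.Build H
  heis_mulA heis_mul1 heis_mulr1 heis_mulV heis_mulrV.

Lemma heis_eq (h h' : H) :
  heis_w h = heis_w h' -> heis_t h = heis_t h' -> h = h'.
Proof. by case: h h' => [w t] [w' t'] /= -> ->. Qed.
End HeisenbergGroup.

Record representation (F : fieldType) (G : groupType) (V : lmodType F) :=
  Representation {
    rep_fun :> G -> {linear V -> V};
    rep1 : forall v, rep_fun 1%g v = v;
    repM : forall g h v, rep_fun (g * h)%g v = rep_fun g (rep_fun h v)
  }.

Definition irreducible_rep (F : fieldType) (G : groupType) (V : lmodType F)
    (rho : representation G V) : Prop :=
  (exists v : V, v != 0) /\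
  forall U : {pred V}, submod_closed U ->
    (forall g v, v \in U -> rho g v \in U) ->
    (forall v, v \in U -> v = 0) \/ (forall v, v \in U).

Definition isomorphic_rep (F : fieldType) (G : groupType) (V V' : lmodType F)
    (rho : representation G V) (rho' : representation G V') : Prop :=
  exists2 T : {linear V -> V'}, bijective T &
    forall g v, T (rho g v) = rho' g (T v).

(* The center of H_beta(W) is {(0, t)}, identified with R = O / m^2. *)
Definition has_central_char (F : fieldType) (A T : zmodType)
    (b : biadditive A T) (psi : T -> F) (V : lmodType F)
    (rho : representation (heis b) V) : Prop :=
  forall t v, rho (Heis 0 t) v = psi t *: v.

(* rho is "the" irreducible representation with central character psi: it is
   one, and every other one is isomorphic to it. *)
Definition is_Heisenberg_rep (F : fieldType) (A T : zmodType)
    (b : biadditive A T) (psi : T -> F) (V : lmodType F)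
    (rho : representation (heis b) V) : Prop :=
  [/\ irreducible_rep rho, has_central_char psi rho &
    forall (V' : lmodType F) (rho' : representation (heis b) V'),
      irreducible_rep rho' -> has_central_char psi rho' ->
      isomorphic_rep rho rho'].

Section Groups.
Context {R : realType} {Q : Q2_field R} {d : nat} {K : unramified_ext Q d}.
Context {m : nat} (W : symplectic_space K m).

Lemma formB'Dl (u v w : W) : formB' (u + v) w = formB' u w + formB' v w.
Proof. by rewrite /formB' formBDl mulrDr. Qed.
Lemma formB'Dr (w u v : W) : formB' w (u + v) = formB' w u + formB' w v.
Proof. by rewrite /formB' formBDr mulrDr. Qed.

Definition HB' := heis (Biadditive formB'Dl formB'Dr).
Definition HB'_O := heis (Biadditive (@formB'ODl _ _ _ _ _ W) (@formB'ODr _ _ _ _ _ W)).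
Definition Hbeta := heis (Biadditive (@betaDl _ _ _ _ _ W) (@betaDr _ _ _ _ _ W)).
HB.instance Definition _ := Group.on HB'.
HB.instance Definition _ := Group.on HB'_O.
HB.instance Definition _ := Group.on Hbeta.

Definition HB'_incl (h : HB'_O) : HB' := Heis (val (heis_w h)) (val (heis_t h)).

(* H_{B'}(W_m) as a subset of H_{B'}(W_O) *)
Definition HB'_m : {pred HB'_O} :=
  [pred h : HB'_O | (heis_w h \in lat_m W) && (heis_t h \in ideal_m2 K)].

(* The projection (w, t) |-> (w mod W_m, t mod m^2); the next lemmas say that it
   identifies H_{B'}(W_O) / H_{B'}(W_m) with H_beta(W). *)
Definition HB'_red (h : HB'_O) : Hbeta :=
  Heis (to_resW (heis_w h)) (to_res (heis_t h)).

Lemma HB'_inclM : {morph HB'_incl : g h / (g * h)%g}.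
Proof.
move=> [u r] [v s]; apply: heis_eq; first exact: (raddfD val).
rewrite [LHS](raddfD val) -[RHS]/(val r + val s + formB' (val u) (val v)).
by rewrite -val_formB'O; congr (_ + _); exact: (raddfD val).
Qed.

Lemma HB'_redM : {morph HB'_red : g h / (g * h)%g}.
Proof.
move=> [u r] [v s]; apply: heis_eq; first exact: to_resWD.
by rewrite [LHS]to_resD -betaE to_resD.
Qed.

Lemma HB'_red_surj (x : Hbeta) : exists h, HB'_red h = x.
Proof.
case: x => u t; exists (Heis (repr u) (repr t)).
by rewrite /HB'_red /= to_resWK to_resK.
Qed.

Lemma HB'_red_ker (h : HB'_O) : (HB'_red h == 1%g) = (h \in HB'_m).
Proof.
case: h => w t; rewrite -[RHS]/((w \in lat_m W) && (t \in ideal_m2 K)).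
have -> : (w \in lat_m W) = (to_resW w == to_resW 0).
  by rewrite to_resW_eq subr0.
have -> : (t \in ideal_m2 K) = (to_res t == to_res 0).
  by rewrite to_res_eq subr0.
have e0 : to_resW (0 : latO W) = 0 by exact: raddf0.
have e1 : to_res (0 : int_type K) = 0 by exact: raddf0.
rewrite e0 e1; apply/eqP/andP => [[-> ->] //|[/eqP h1 /eqP h2]].
by rewrite /HB'_red /= h1 h2.
Qed.
End Groups.

Section Topology.
Context {R : realType} {Q : Q2_field R} {d : nat} {K : unramified_ext Q d}.
Context {m : nat} (W : symplectic_space K m).

(* W with its topology of finite-dimensional K-space: the product topology in
   the coordinates of the symplectic basis. *)
Definition sp_top : Type := W.
HB.instance Definition _ := Choice.on sp_top.

Definition sp_cylinders : set (set sp_top) :=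
  [set U | exists (i : 'I_(m + m)) (a : K) (eps : R), 0 < eps /\
     U = [set w : W | ue_abs (coord (sp_basis W) i w - a) < eps]].
HB.instance Definition _ := isSubBaseTopological.Build sp_top sp_cylinders id.
End Topology.

Section Functions.
Context {R : realType} {Q : Q2_field R} {d : nat} {K : unramified_ext Q d}.
Context {m : nat} (W : symplectic_space K m).

Definition fct := W -> R[i]^o.
HB.instance Definition _ := GRing.Lmodule.on fct.

Definition locally_constant (f : fct) : Prop :=
  forall w : sp_top W, \forall w' \near w, f w' = f w.

Definition compactly_supported (f : fct) : Prop :=
  compact (closure [set w : sp_top W | f w != 0]).

Variable Psi : K -> R[i].

Definition S_L' : set fct := [set f |
  [/\ locally_constant f, compactly_supported f &
    forall l w : W, l \in lat_L' W -> f (l + w) = Psi (- formB' l w) * f w]].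

Definition Pi'_Psi (h : HB' W) (f : fct) : fct :=
  fun w => Psi (heis_t h + formB' w (heis_w h)) * f (w + heis_w h).

Definition V_psi_pred : {pred fct} :=
  [pred f | `[< S_L' f /\ forall w : W, f w != 0 -> w \in lat_half W >]].

Lemma V_psi_closed : submod_closed V_psi_pred.
Proof.
split.
  rewrite inE; split; last by move=> w /=; rewrite eqxx.
  split=> [w||l w _]; last by rewrite mulr0.
    by near=> w'.
  rewrite /compactly_supported [X in closure X](_ : _ = set0) ?closure0.
    exact: compact0.
  by apply/seteqP; split=> w //=; rewrite eqxx.
move=> a f g; have E w : (a *: f + g) w = a * f w + g w by [].
rewrite !inE => -[[lf cf Lf] sf] [[lg cg Lg] sg]; split.
  split=> [w||l w hl].
  - near=> w'; rewrite !E; congr (_ + _); last by near: w'; exact: lg.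
    by congr (_ * _); near: w'; exact: lf.
  - apply: (subclosed_compact _ (compactU cf cg)); first exact: closed_closure.
    rewrite -closureU; apply: closure_subset => w /=.
    case: (eqVneq (f w) 0) => [f0|]; last by left.
    by case: (eqVneq (g w) 0) => [g0|]; [rewrite E f0 g0 mulr0 addr0 eqxx|right].
  - by rewrite !E Lf // Lg // [a * _]mulrCA -mulrDr.
move=> w; case: (eqVneq (f w) 0) => [f0|/sf //].
case: (eqVneq (g w) 0) => [g0|/sg //].
by rewrite E f0 g0 mulr0 addr0 eqxx.
Unshelve. all: by end_near.
Qed.

Record V_psi := VPsi { V_psi_val : fct; _ : V_psi_val \in V_psi_pred }.
HB.instance Definition _ := GRing.isSubmodClosed.Build _ fct V_psi_pred V_psi_closed.
HB.instance Definition _ := [isSub for V_psi_val].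
HB.instance Definition _ := [Choice of V_psi by <:].
HB.instance Definition _ := [SubChoice_isSubLmodule of V_psi by <:].
End Functions.

Section Characters.
Context {R : realType} {Q : Q2_field R} {d : nat} {K : unramified_ext Q d}.

(* Continuity and unitarity follow from triviality on m^2: K / m^2 is a discrete
   torsion group. *)
Definition is_character (Psi : K -> R[i]) : Prop :=
  Psi 0 = 1 /\ {morph Psi : x y / x + y >-> x * y}.

Definition level_m2 (Psi : K -> R[i]) : Prop :=
  (forall x, x \in mpow K 2 -> Psi x = 1) /\
  exists2 x, x \in mpow K 1 & Psi x != 1.

(* The restriction of Psi to O, viewed on R = O / m^2. *)
Definition res_char (Psi : K -> R[i]) (r : res_ring K) : R[i] :=
  Psi (val (repr r)).

Lemma res_charE (Psi : K -> R[i]) : is_character Psi -> level_m2 Psi ->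
  forall x : int_type K, res_char Psi (to_res x) = Psi (val x).
Proof.
move=> [_ PsiD] [Psi1 _] x; rewrite /res_char; set y := repr _.
have /eqP := to_resK (to_res x); rewrite -/y to_res_eq => /Psi1 h.
by rewrite -[y](subrK x) (raddfD val) PsiD h mul1r.
Qed.

(* Faithfulness is relative to the ring structure: the kernel of psi contains no
   nonzero ideal. Injectivity of psi implies this, and is impossible for d > 1
   since (R, +) is isomorphic to (Z/4)^d. *)
Definition faithful_char (psi : res_ring K -> R[i]) : Prop :=
  forall r, (forall s, psi (s * r) = 1) -> r = 0.
End Characters.

(* Main.v *)
From HB Require Import structures.
From mathcomp Require Import all_boot all_order all_algebra all_field.
From mathcomp Require Import reals complex.
From mathcomp Require Import all_classical topology.
From mathcomp Require Import finmap zify ring lra.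
Require Import Defs.

(** Since the form B' sends L' x W_O into m^2, where Psi is trivial, the
    functions in V_psi are exactly the functions on W_O that are invariant under
    L'; and W_O / L' = X_O / 2 X_O. On such functions X^* acts by multiplication
    by the characters psi(beta(_, u)) and X acts by translations
    ([eval_at_rho]), while H_B'(W_m) acts trivially ([Pi'_trivial]), so that the
    action descends to a representation of H_beta(W) ([lattice_rep]).

    Faithfulness of psi makes the commutator pairing
    psi(beta(u, w) - beta(w, u)) of W nondegenerate
    ([beta_nondegenerate]), and this is what forces both properties of the
    Heisenberg representation.
    - Irreducibility ([lattice_rep_irreducible]): translate a nonzero function
      of an invariant subspace so that it does not vanish at 0; averaging it
      over X^* then kills all its values outside L', by orthogonality of
      characters, and leaves a multiple of the indicator function delta of L'
      ([sum_Xs_elt]). The translates of delta under X span V_psi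
      ([sum_X_elt]).
    - Uniqueness ([heis_rep_unique], a Stone-von Neumann theorem for
      Heisenberg groups of finite abelian groups with nondegenerate commutator
      pairing): given a linear
      form lambda on V and a vector v' of V', the average over W of the rank one
      map lambda (x) v' intertwines the two representations. Were it zero for
      all translates of v' under W, Fourier inversion on W would give lambda = 0 or
      v' = 0. A nonzero intertwiner between irreducible representations is
      bijective.

    Two facts about K enter. Averages over W are finite sums because O / 2O is
    finite ([residue_generators], [resW_finite]). And delta belongs to V_psi only
    because W_O is compact ([lat_half_compact]). Both come from Q_2. Its integers
    are 0 or 1 modulo 2, by density of the rationals; hence a relation of linear
    dependence over Q_2, scaled to have a unit among its integral coefficients,
    reduces to a nontrivial relation modulo 2 with coefficients 0 and 1, so that
    O / 2O has dimension at most [K : Q_2] over the field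
    with two elements. Lifts of a generating family then represent every integer
    by binary expansions, which converge in Q_2, and W_O is the image of a
    product of two-point spaces. *)

Set Implicit Arguments.
Unset Strict Implicit.
Unset Printing Implicit Defensive.

Import Order.TTheory GRing.Theory Num.Theory.
Local Open Scope classical_set_scope.
Local Open Scope ring_scope.

(** * Sums over a finite abelian group *)

Section CharacterSums.
(* Finiteness of A is expressed by an enumeration s, since the quotient W_O / W_m
   is not presented as a finite type. *)
Variables (A : zmodType) (s : seq A).
Hypotheses (s_uniq : uniq s) (s_full : forall a, a \in s).

Lemma sum_translate (V : zmodType) (G : A -> V) (a : A) :
  \sum_(w <- s) G (w + a) = \sum_(w <- s) G w.
Proof.
rewrite -(big_map (fun w => w + a) xpredT G); apply: perm_big.
apply: uniq_perm => // [|w]; first by rewrite map_inj_uniq //; exact: addIr.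
by rewrite s_full; apply/mapP; exists (w - a); rewrite ?subrK.
Qed.

(** Translating the sum by a multiplies it by chi(a), which is not 1. *)
Lemma character_sum0 (F : fieldType) (chi : A -> F) (a : A) :
  {morph chi : u v / u + v >-> u * v} -> chi a != 1 ->
  \sum_(w <- s) chi w = 0.
Proof.
move=> chiD a1; set S := \sum_(w <- s) _.
have : S * chi a = S.
  by rewrite -[RHS](sum_translate _ a) mulr_suml; apply: eq_bigr => w _; rewrite chiD.
move/eqP; rewrite -subr_eq0 -[X in _ - X]mulr1 -mulrBr mulf_eq0 subr_eq0.
by rewrite (negbTE a1) orbF => /eqP.
Qed.
End CharacterSums.

(** * Uniqueness of the Heisenberg representation *)

Section StoneVonNeumann.
Variables (F : numFieldType) (A T : zmodType) (b : biadditive A T).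
Variables (psi : T -> F).
Hypotheses (psi0 : psi 0 = 1) (psiD : {morph psi : x y / x + y >-> x * y}).
Hypothesis b_nondeg :
  forall w, w != 0 -> exists u, psi (b u w - b w u) != 1.
Variables (s : seq A).
Hypotheses (s_uniq : uniq s) (s_full : forall a, a \in s).

(** Since the elements (0, t) act by scalars, this is the rule for moving a group
    element through the operators attached to the section w |-> (w, 0). *)
Lemma heis_split (u w : A) (t : T) :
  (Heis w 0 * Heis u t = Heis 0 (t + b w u) * Heis (w + u) 0 :> heis b)%g.
Proof. by apply: heis_eq; rewrite /= ?add0r // biadd0l !addr0. Qed.

(** Conjugating (w, 0)^-1 by (u, 0) multiplies it by a central element: the
    commutator pairing of w and u. *)
Lemma heis_cocycle (u w : A) :
  ((Heis w 0)^-1 * Heis u 0 =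
     Heis 0 (b u w - b w u) * (Heis u 0 * (Heis w 0)^-1) :> heis b)%g.
Proof.
apply: (mulgI (Heis w 0)); apply: (mulIg (Heis w 0)).
rewrite !mulgA mulgV mul1g mulgVK.
by apply: heis_eq; rewrite /= ?biadd0l ?biadd0r ?addr0 ?add0r ?subrK // addrC.
Qed.

Section TwoRepresentations.
Variables (V V' : lmodType F).
Variables (rho : representation (heis b) V) (rho' : representation (heis b) V').
Hypotheses (rho_irr : irreducible_rep rho) (rho'_irr : irreducible_rep rho').
Hypotheses (rho_psi : has_central_char psi rho)
           (rho'_psi : has_central_char psi rho').
Variable (lambda : {linear V -> F^o}).

(** The average over the group, modulo its center, of the conjugates of the rank
    one map v |-> lambda(v) v'; the center drops out because it acts by the same
    scalars on V and on V'. *)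
Definition intertwiner (v' : V') (v : V) : V' :=
  \sum_(w <- s) (lambda (rho (Heis w 0) v) : F) *: rho' (Heis w 0)^-1%g v'.

Lemma intertwiner_linear v' : linear (intertwiner v').
Proof.
move=> a u v; rewrite /intertwiner scaler_sumr -big_split /=.
by apply: eq_bigr => w _; rewrite !linearP scalerDl scalerA.
Qed.

HB.instance Definition _ v' :=
  GRing.isLinear.Build F V V' *:%R (intertwiner v') (intertwiner_linear v').

Lemma intertwinerP v' h v :
  intertwiner v' (rho h v) = rho' h (intertwiner v' v).
Proof.
case: h => u t; rewrite /intertwiner linear_sum.
rewrite -[RHS](sum_translate s_uniq s_full _ u); apply: eq_bigr => w _.
rewrite -repM heis_split repM rho_psi linearZ /= linearZ /= -repM.
have -> : (Heis u t * (Heis (w + u) 0)^-1 =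
    Heis 0 (t + b w u) * (Heis w 0)^-1 :> heis b)%g.
  apply: (mulgI (Heis w 0)); rewrite mulgA heis_split mulgK.
  apply: (mulIg (Heis w 0)); rewrite -!mulgA mulVg mulg1.
  by apply: heis_eq; rewrite /= ?biadd0l ?biadd0r ?addr0 ?add0r.
by rewrite repM rho'_psi scalerA mulrC.
Qed.

(** Replacing v' by its image under (u, 0) twists the w-term of the average by the
    commutator pairing of u and w. If all these averages vanished at v0, then so
    would their sum over u, in which nondegeneracy leaves only the term w = 0,
    namely #|A| lambda(v0) v'. *)
Lemma intertwiner_neq0 (v0 : V) (v' : V') :
  lambda v0 != 0 -> v' != 0 -> exists u, intertwiner (rho' (Heis u 0) v') v0 != 0.
Proof.
move=> l0 v'0; apply: contrapT => /forallNP h.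
have {}h u : \sum_(w <- s) ((lambda (rho (Heis w 0) v0) : F) *
    psi (b u w - b w u)) *: rho' (Heis w 0)^-1%g v' = 0.
  have := h u; move/negP; rewrite negbK => /eqP h0.
  (* Cancel the invertible operator of (u, 0) on the left. *)
  rewrite -(rep1 rho' (\sum_(w <- s) _)) -(mulVg (Heis u 0)) repM.
  rewrite (_ : rho' (Heis u 0) _ = 0) ?linear0 // -[RHS]h0 linear_sum.
  apply: eq_bigr => w _; rewrite linearZ /= -!repM heis_cocycle (repM _ (Heis 0 _)).
  by rewrite rho'_psi scalerA.
have : \sum_(w <- s) ((lambda (rho (Heis w 0) v0) : F) *
    \sum_(u <- s) psi (b u w - b w u)) *: rho' (Heis w 0)^-1%g v' = 0.
  under eq_bigr do rewrite mulr_sumr scaler_suml.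
  by rewrite exchange_big big1 // => u _; exact: h.
rewrite (bigD1_seq 0) //= [X in _ + X]big1 => [|w w0].
  rewrite addr0 -[Heis 0 0]/(1%g : heis b) invg1 !rep1.
  under eq_bigr do rewrite biadd0l biadd0r subrr psi0.
  rewrite big_const_seq count_predT iter_addr_0 => /eqP.
  rewrite scaler_eq0 (negbTE v'0) orbF mulf_eq0 (negbTE l0) /=.
  rewrite pnatr_eq0 => /eqP/size0nil s0.
  by have := s_full 0; rewrite s0.
have [u0 u01] := b_nondeg w0.
rewrite (character_sum0 s_uniq s_full (a := u0) _ u01) ?mulr0 ?scale0r //.
by move=> x y; rewrite -psiD biaddDl biaddDr opprD addrACA.
Qed.

(** Schur's lemma: the kernel and the image are invariant subspaces. *)
Lemma intertwiner_bij v' v0 : intertwiner v' v0 != 0 -> bijective (intertwiner v').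
Proof.
move=> n0.
have inj : injective (intertwiner v').
  pose U : {pred V} := [pred v | intertwiner v' v == 0].
  have Uc : submod_closed U.
    split; first by rewrite inE linear0.
    by move=> a x y; rewrite !inE => /eqP hx /eqP hy; rewrite linearP /= hx hy scaler0 addr0.
  have Us g v : v \in U -> rho g v \in U.
    by rewrite !inE intertwinerP => /eqP ->; rewrite linear0.
  case: (rho_irr.2 U Uc Us) => hU.
    move=> x y xy; apply/eqP; rewrite -subr_eq0; apply/eqP/hU.
    by rewrite inE linearB /= xy subrr.
  by have := hU v0; rewrite inE (negbTE n0).
have surj v : exists x, intertwiner v' x = v.
  pose U : {pred V'} := [pred v | `[< exists x, intertwiner v' x = v >]].
  have Uc : submod_closed U.
    split; first by apply/asboolP; exists 0; rewrite linear0.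
    move=> a x y /asboolP[x' <-] /asboolP[y' <-]; apply/asboolP.
    by exists (a *: x' + y'); rewrite linearP.
  have Us g x : x \in U -> rho' g x \in U.
    by move=> /asboolP[x' <-]; apply/asboolP; exists (rho g x'); rewrite intertwinerP.
  case: (rho'_irr.2 U Uc Us) => hU; last by have /asboolP := hU v.
  have : intertwiner v' v0 \in U by apply/asboolP; exists v0.
  by move/hU => h; rewrite h eqxx in n0.
have [g gK] := choice surj.
by exists g => // x; apply: inj; rewrite gK.
Qed.

Lemma heis_rep_unique (v0 : V) : lambda v0 != 0 -> isomorphic_rep rho rho'.
Proof.
move=> l0; have [[v' v'0] _] := rho'_irr.
have [u /intertwiner_bij bij] := intertwiner_neq0 l0 v'0.
by exists (intertwiner (rho' (Heis u 0) v')) => // g v; exact: intertwinerP.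
Qed.
End TwoRepresentations.
End StoneVonNeumann.

(** * Ultrametric absolute values and residues in Q_2 *)

Section UltrametricAbs.
Variables (R : realType) (k : fieldType) (abs : k -> R).
Hypothesis absP : ultrametric_abs abs.

Lemma uabs0 : abs 0 = 0. Proof. exact/(abs_eq0 absP). Qed.

Lemma uabs_neq0 x : x != 0 -> abs x != 0.
Proof. by apply: contra => /eqP/(abs_eq0 absP) ->. Qed.

Lemma uabs1 : abs 1 = 1.
Proof.
by apply: (mulfI (uabs_neq0 (oner_neq0 k))); rewrite -(absM absP) !mulr1.
Qed.

Lemma uabsN x : abs (- x) = abs x.
Proof.
suff h : abs (-1) = 1 by rewrite -mulN1r (absM absP) h mul1r.
have := absM absP (-1) (-1); rewrite mulrNN mulr1 uabs1 => /esym/eqP.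
rewrite -expr2 sqrf_eq1 => /orP[/eqP //|/eqP h].
by have := abs_ge0 absP (-1); rewrite h ler0N1.
Qed.

Lemma uabsX x n : abs (x ^+ n) = abs x ^+ n.
Proof. by elim: n => [|n IH]; rewrite ?uabs1 // !exprS (absM absP) IH. Qed.

Lemma uabsV x : abs x^-1 = (abs x)^-1.
Proof.
have [->|x0] := eqVneq x 0; first by rewrite invr0 uabs0 invr0.
by apply: (mulfI (uabs_neq0 x0)); rewrite -(absM absP) !divff ?uabs1 ?uabs_neq0.
Qed.

Lemma uabsB_le x y e : abs x <= e -> abs y <= e -> abs (x - y) <= e.
Proof.
by move=> hx hy; apply: le_trans (absD absP _ _) _; rewrite ge_max uabsN hx.
Qed.

Lemma uabsD_le x y e : abs x <= e -> abs y <= e -> abs (x + y) <= e.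
Proof.
by move=> hx hy; apply: le_trans (absD absP _ _) _; rewrite ge_max hx.
Qed.

Lemma uabs_sum_le (I : Type) (r : seq I) (P : pred I) (f : I -> k) e :
  0 <= e -> (forall i, P i -> abs (f i) <= e) ->
  abs (\sum_(i <- r | P i) f i) <= e.
Proof.
move=> e0 h; elim/big_ind: _ => //; first by rewrite uabs0.
by move=> x y; exact: uabsD_le.
Qed.
End UltrametricAbs.

Section TwoAdic.
Variables (R : realType) (Q : Q2_field R).
Let absP := Q2_absP Q.

Lemma logn2_odd n : odd n -> logn 2 n = 0%N.
Proof. by move=> o; rewrite lognE dvdn2 o !andbF. Qed.

Lemma Q2_abs_nat (n : nat) : (0 < n)%N -> Q2_abs (n%:R : Q) = 2^-1 ^+ logn 2 n.
Proof.
move=> n0; have -> : (n%:R : Q) = ratr n%:Q by rewrite ratr_nat.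
rewrite Q2_abs_rat /abs2_rat intr_eq0 denq_int numq_int /=.
by case: n n0 => // n _; rewrite logn1 expr0 div1r exprVn.
Qed.

Lemma Q2_abs2 : Q2_abs (2 : Q) = 2^-1.
Proof. by rewrite Q2_abs_nat // lognn. Qed.

Lemma Q2_abs_int_odd (z : int) :
  odd `|z|%N -> Q2_abs (z%:~R : Q) = 1.
Proof.
case: (intP z) => [//|n|n] o; rewrite ?mulrNz ?(uabsN absP) Q2_abs_nat //.
  by rewrite logn2_odd.
by rewrite abszN in o; rewrite logn2_odd.
Qed.

Lemma Q2_abs_int_le1 (z : int) : Q2_abs (z%:~R : Q) <= 1.
Proof.
case: (intP z) => [|n|n]; rewrite ?(uabs0 absP) // ?mulrNz ?(uabsN absP) Q2_abs_nat //.
all: by rewrite exprn_ile1 // ?invr_ge0 // invf_le1 // ler1n.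
Qed.

Lemma Q2_abs_int_even (z : int) :
  ~~ odd `|z|%N -> Q2_abs (z%:~R : Q) <= 2^-1.
Proof.
move=> o; have [y ->] : exists y : int, z = y * 2.
  by apply/dvdzP; rewrite dvdzE dvdn2.
rewrite rmorphM (absM absP) Q2_abs2 ler_piMl ?invr_ge0 //.
exact: Q2_abs_int_le1.
Qed.

(** A rational at distance less than 1 from an integer c of Q_2 has odd denominator,
    so it is congruent to the parity of its numerator; by density some rational
    lies within 1/2 of c. *)
Lemma Q2_residue (c : Q) : Q2_abs c <= 1 ->
  exists a : bool, Q2_abs (c - a%:R) <= 2^-1.
Proof.
move=> c1; have half0 : (0 : R) < 2^-1 by rewrite invr_gt0.
have [q cq] := Q2_dense c half0.
have q1 : Q2_abs (ratr q : Q) <= 1.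
  rewrite -[ratr q](subKr c) (uabsB_le absP) //.
  by apply: le_trans (ltW cq) _; rewrite invf_le1 // ler1n.
have qE : (ratr q : Q) = (numq q)%:~R / (denq q)%:~R by [].
(* An even denominator forces an odd numerator, hence an absolute value at least 2. *)
have dodd : odd `|denq q|%N.
  apply/negP => /negP de.
  have nodd : odd `|numq q|%N.
    apply/negP => /negP ne; have := coprime_num_den q.
    rewrite /coprime => /eqP g.
    have : (2 %| gcdn `|numq q| `|denq q|)%N by rewrite dvdn_gcd !dvdn2 ne.
    by rewrite g.
  have q0 : q != 0 by apply: contraNneq de => ->.
  move: q1; rewrite Q2_abs_rat /abs2_rat (negbTE q0).
  have -> : logn 2 `|numq q|%N = 0%N.
    exact: logn2_odd.
  have : (0 < logn 2 `|denq q|)%N.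
    by rewrite logn_gt0 mem_primes /= absz_gt0 denq_neq0 dvdn2.
  case: (logn _ _) => // n _; rewrite expr0 divr1 leNgt.
  by rewrite exprn_egt1 // ltr1n.
exists (odd `|numq q|%N).
rewrite -[c](subrK (ratr q)) -addrA (uabsD_le absP) // ?(ltW cq) //.
have d1 := Q2_abs_int_odd dodd.
have d0 : ((denq q)%:~R : Q) != 0.
  by apply/eqP => e; move: d1; rewrite e (uabs0 absP) => /eqP; rewrite eq_sym oner_eq0.
have -> : (ratr q - (odd `|numq q|%N)%:R : Q) =
    (numq q - (odd `|numq q|%N)%:R * denq q)%:~R / (denq q)%:~R.
  by rewrite qE rmorphB rmorphM /= mulrBl mulfK // rmorph_nat.
rewrite (absM absP) (uabsV absP) d1 invr1 mulr1; apply: Q2_abs_int_even.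
case: (boolP (odd `|numq q|)) => /=; lia.
Qed.
End TwoAdic.

(** * Finiteness of O / 2O and binary expansions in K *)

Section IntegersCompact.
Variables (R : realType) (Q : Q2_field R) (d : nat) (K : unramified_ext Q d).
Let absQ := Q2_absP Q.
Let absK := ue_absP K.

Lemma ue_absZ (c : Q) (x : K) : ue_abs (c *: x) = Q2_abs c * ue_abs x.
Proof. by rewrite -[c *: x]mulr_algl (absM absK) ue_abs_ext. Qed.

Lemma half_ge0 : (0 : R) <= 2^-1. Proof. by rewrite invr_ge0. Qed.

(** More than [K : Q_2] integers of K are dependent modulo 2: divide a relation over
    Q_2 by its largest coefficient and reduce the coefficients modulo 2. *)
Lemma bits_dependent n (u : 'I_n -> K) :
  (\dim {:K} < n)%N -> (forall i, ue_abs (u i) <= 1) ->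
  exists2 a : {ffun 'I_n -> bool}, exists i, a i &
    ue_abs (\sum_i (a i)%:R * u i) <= 2^-1.
Proof.
move=> dn u1.
have /freeP : ~~ free [tuple u i | i < n].
  apply/negP; rewrite /free size_tuple => /eqP e.
  by move: dn; rewrite -e ltnNge dimvS // subvf.
move=> /existsNP[c /not_implyP[]]; under eq_bigr do rewrite -tnth_nth tnth_mktuple.
move=> c0 /existsNP[i0 /eqP ci0].
case: (@arg_maxP _ _ _ i0 xpredT (fun i => Q2_abs (c i)) isT) => im _ hm.
have cm0 : c im != 0.
  apply/negP => /eqP e; have := hm i0 isT; rewrite /= e (uabs0 absQ) => h.
  have := abs_ge0 absQ (c i0) => h'.
  by have /eqP := le_anti (introT andP (conj h h')); rewrite (negbTE (uabs_neq0 absQ ci0)).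
have c1 i : Q2_abs (c i / c im) <= 1.
  rewrite (absM absQ) (uabsV absQ) ler_pdivrMr ?mul1r; first exact: hm.
  by rewrite lt_def (uabs_neq0 absQ) ?(abs_ge0 absQ).
have [a ha] := choice (fun i => Q2_residue (c1 i)).
(* The coefficient of index im is 1, so its residue cannot be 0. *)
exists (finfun a).
  exists im; rewrite ffunE; have := ha im; rewrite divff //; case: (a im) => //.
  by rewrite subr0 (uabs1 absQ) leNgt invf_lt1 // ltr1n.
have -> : \sum_i ((finfun a) i)%:R * u i =
    - \sum_i (c i / c im - (a i)%:R) *: u i.
  apply/eqP; rewrite -addr_eq0 -big_split /=.
  under eq_bigr => i _ do rewrite ffunE scalerBl scaler_nat mulr_natl addrC subrK mulrC -scalerA.
  by rewrite -scaler_sumr c0 scaler0.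
rewrite (uabsN absK) (uabs_sum_le absK) ?half_ge0 // => i _.
by rewrite ue_absZ -[2^-1]mulr1 ler_pM ?(abs_ge0 absQ) ?(abs_ge0 absK).
Qed.

(** A family of maximal size among those independent modulo 2 over the field with
    two elements. By maximality, adjoining x creates a relation, in which x must
    occur. *)
Lemma residue_generators : exists n (u : 'I_n -> K),
  (forall i, ue_abs (u i) <= 1) /\
  forall x, ue_abs x <= 1 -> exists a : {ffun 'I_n -> bool},
    ue_abs (x - \sum_i (a i)%:R * u i) <= 2^-1.
Proof.
pose indep n := exists2 u : 'I_n -> K, forall i, ue_abs (u i) <= 1 &
  forall a : {ffun 'I_n -> bool},
    ue_abs (\sum_i (a i)%:R * u i) <= 2^-1 -> forall i, ~~ a i.
have ex : exists n, `[< indep n >].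
  by exists 0%N; apply/asboolP; exists (fun=> 0) => [i|a _ []//]; rewrite (uabs0 absK).
have bound n : `[< indep n >] -> (n <= \dim {:K})%N.
  move=> /asboolP[u u1 ui]; rewrite leqNgt; apply/negP => dn.
  by have [a [i ai] /ui/(_ i)] := bits_dependent dn u1; rewrite ai.
case: (ex_maxnP ex bound) => n /asboolP[u u1 ui] nmax.
exists n, u; split=> // x x1.
pose u' (i : 'I_n.+1) := if unlift ord0 i is Some j then u j else x.
have u'1 i : ue_abs (u' i) <= 1 by rewrite /u'; case: unlift.
have : ~ forall a : {ffun 'I_n.+1 -> bool},
    ue_abs (\sum_i (a i)%:R * u' i) <= 2^-1 -> forall i, ~~ a i.
  move=> h; suff : (n.+1 <= n)%N by rewrite ltnn.
  by apply: nmax; apply/asboolP; exists u'.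
move=> /existsNP[a /not_implyP[]]; rewrite big_ord_recl /u' unlift_none.
under eq_bigr do rewrite liftK.
move=> ha /existsNP[i /negP]; rewrite negbK => ai.
exists [ffun i => a (lift ord0 i)]; under eq_bigr do rewrite ffunE.
have a0 : a ord0.
  apply: contraT => a0; move: ha; rewrite (negbTE a0) mul0r add0r => ha.
  move: ai; case: (unliftP ord0 i) => [j -> aj|-> ai]; last by rewrite ai in a0.
  have := ui [ffun i => a (lift ord0 i)]; under eq_bigr do rewrite ffunE.
  by move=> /(_ ha j); rewrite ffunE aj.
move: ha; rewrite a0 mul1r; set S := \sum_i _ => ha.
(* The relation gives x = - S modulo 2, and signs do not matter modulo 2. *)
have -> : x - S = x + S - 2 * S by ring.
apply: (uabsB_le absK ha); rewrite (absM absK) ue_abs2 ler_piMr ?half_ge0 //.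
apply: (uabs_sum_le absK) => // j _.
by case: (a _); rewrite ?mul1r ?mul0r ?(uabs0 absK).
Qed.

End IntegersCompact.

Section Digits.
Variables (R : realType) (Q : Q2_field R).
Let absQ := Q2_absP Q.

Lemma half_exp_small (e : R) : 0 < e -> exists N, 2^-1 ^+ N < e.
Proof.
move=> e0; exists (Num.bound e^-1); rewrite exprVn invf_plt ?posrE ?exprn_gt0 //.
apply: lt_trans (archi_boundP _) _; first by rewrite invr_ge0 ltW.
by rewrite -natrX ltr_nat ltn_expl.
Qed.

(** The sum of a 2-adic series with binary digits, as a function of the digits, with
    an error bound that makes it continuous. *)
Lemma binary_series : exists c : (nat -> bool) -> Q, forall a N,
  Q2_abs (c a - \sum_(k < N) 2 ^+ k * (a k)%:R) <= 2^-1 ^+ N.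
Proof.
suff /choice[c hc] : forall a : nat -> bool, exists l : Q, forall N,
    Q2_abs (l - \sum_(0 <= k < N) 2 ^+ k * (a k)%:R) <= 2^-1 ^+ N.
  by exists c => a N; have := hc a N; rewrite big_mkord.
move=> a; pose S N : Q := \sum_(0 <= k < N) 2 ^+ k * (a k)%:R.
have SB N M : (N <= M)%N -> Q2_abs (S M - S N) <= 2^-1 ^+ N.
  move=> NM; rewrite /S (big_cat_nat (n := N)) //= [_ + \sum_(_ <= _ < _) _]addrC addrK big_nat.
  apply: (uabs_sum_le absQ) => [|k /andP[Nk _]]; first by rewrite exprn_ge0 ?half_ge0.
  rewrite (absM absQ) (uabsX absQ) Q2_abs2.
  apply: le_trans (ler_wiXn2l _ _ Nk); rewrite ?half_ge0 ?invf_le1 ?ler1n //.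
  case: (a k); rewrite ?(uabs1 absQ) ?(uabs0 absQ) ?mulr1 // mulr0.
  by rewrite exprn_ge0 ?half_ge0.
have SC (e : R) : 0 < e -> exists N, forall i j, (N <= i)%N -> (N <= j)%N ->
    Q2_abs (S i - S j) < e.
  move=> /half_exp_small[N hN]; exists N => i j Ni Nj.
  apply: le_lt_trans hN; rewrite -(subrK (S N) (S i)) -addrA (uabsD_le absQ) ?SB //.
  by rewrite -opprB (uabsN absQ) SB.
have [l hl] := Q2_complete SC; exists l => N.
have p0 : (0 : R) < 2^-1 ^+ N by rewrite exprn_gt0 ?invr_gt0.
have [M hM] := hl _ p0.
rewrite -(subrK (S (maxn M N)) l) -addrA (uabsD_le absQ) ?SB ?leq_maxr //.
by rewrite -opprB (uabsN absQ) ltW // hM ?leq_maxl.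
Qed.

Variables (d : nat) (K : unramified_ext Q d).
Let absK := ue_absP K.

(** Subtract the residue, divide by 2 and start again: the remainder after N steps is
    2^N times an integer. *)
Lemma digit_expansion n (u : 'I_n -> K) :
  (forall x, ue_abs x <= 1 -> exists a : {ffun 'I_n -> bool},
    ue_abs (x - \sum_i (a i)%:R * u i) <= 2^-1) ->
  forall x, ue_abs x <= 1 -> exists a : 'I_n -> nat -> bool, forall N,
    ue_abs (x - \sum_i (\sum_(k < N) 2 ^+ k * (a i k)%:R : Q) *: u i) <= 2^-1 ^+ N.
Proof.
move=> hu.
have /choice[f hf] : forall x : K, exists a : {ffun 'I_n -> bool},
    ue_abs x <= 1 -> ue_abs (x - \sum_i (a i)%:R * u i) <= 2^-1.
  move=> x; have [/hu[a ha]|hx] := leP (ue_abs x) 1; first by exists a.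
  by exists [ffun=> false] => x1; move: hx; rewrite ltNge x1.
(* y k is the integer that remains to be expanded after k digits. *)
move=> x x1; pose y := fix y k := if k is k'.+1 then
  (y k' - \sum_i (f (y k') i)%:R * u i) / 2 else x.
have y1 k : ue_abs (y k) <= 1.
  elim: k => //= k /hf IH; rewrite (absM absK) (uabsV absK) ue_abs2 invrK.
  by rewrite -ler_pdivlMr // div1r.
exists (fun i k => f (y k) i) => N.
suff -> : x - \sum_i (\sum_(k < N) 2 ^+ k * (f (y k) i)%:R : Q) *: u i = 2 ^+ N * y N.
  by rewrite (absM absK) (uabsX absK) ue_abs2 ler_piMr // exprn_ge0 ?half_ge0.
elim: N => [|N IH].
  by rewrite mul1r big1 ?subr0 // => i _; rewrite big_ord0 scale0r.
have natE (b : bool) z : (2 ^+ N * b%:R : Q) *: z = 2 ^+ N * (b%:R * z) :> K.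
  by rewrite -natrX -natrM scaler_nat -[LHS]mulr_natl natrM natrX mulrA.
under eq_bigr => i _ do rewrite big_ord_recr /= scalerDl natE.
rewrite big_split /= opprD addrA IH -mulr_sumr -mulrBr exprSr -mulrA.
by rewrite [2 * _]mulrC divfK // ue_two_neq0.
Qed.
End Digits.

(** * Coordinates in the symplectic basis *)

Section Coordinates.
Variables (k : fieldType) (m : nat) (W : symplectic_space k m).

Definition sp_coord (i : 'I_(m + m)) (w : W) : k := coord (sp_basis W) i w.

Lemma sp_coordE (w : W) : w = \sum_i sp_coord i w *: tnth (sp_basis W) i.
Proof.
under eq_bigr do rewrite (tnth_nth 0).
by apply: coord_basis; [exact: sp_basisP | exact: memvf].
Qed.

Lemma sp_coord_sum (c : 'I_(m + m) -> k) i :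
  sp_coord i (\sum_j c j *: tnth (sp_basis W) j) = c i.
Proof.
under eq_bigr do rewrite (tnth_nth 0).
by apply: coord_sum_free; exact: basis_free (sp_basisP W).
Qed.

Lemma sp_coordB i (u v : W) : sp_coord i (u - v) = sp_coord i u - sp_coord i v.
Proof. exact: linearB. Qed.
Lemma sp_coordZ i (a : k) (u : W) : sp_coord i (a *: u) = a * sp_coord i u.
Proof. exact: linearZ. Qed.

Lemma formB_coord (u v : W) :
  formB u v = \sum_i sp_coord (lshift m i) u * sp_coord (rshift m i) v.
Proof.
rewrite {1}(sp_coordE u) {1}(sp_coordE v) formB_suml big_split_ord /=.
rewrite [X in _ + X]big1 ?addr0 => [|i _].
  apply: eq_bigr => i _; rewrite formB_sumr (bigD1 (rshift m i)) //= big1 ?addr0.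
    rewrite formBZl formBZr formB_basis; case: existsP => [_|[]]; first by rewrite mulr1.
    by exists i; rewrite !eqxx.
  move=> j ji; rewrite formBZl formBZr formB_basis; case: existsP; last by rewrite !mulr0.
  by move=> [a /andP[/eqP/lshift_inj ia /eqP jE]]; rewrite jE ia eqxx in ji.
rewrite formB_sumr big1 // => j _; rewrite formBZl formBZr formB_basis.
case: existsP; last by rewrite !mulr0.
by move=> [a /andP[]]; rewrite eq_rlshift.
Qed.

Lemma sp_coord_basis i j : sp_coord i (tnth (sp_basis W) j) = (j == i)%:R.
Proof.
have -> : tnth (sp_basis W) j = \sum_l (l == j)%:R *: tnth (sp_basis W) l.
  rewrite (bigD1 j) //= eqxx scale1r big1 ?addr0 // => l /negbTE ->.
  by rewrite scale0r.
by rewrite sp_coord_sum eq_sym.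
Qed.

Lemma formB_rbasis (v : W) i : formB v (tnth (sp_basis W) (rshift m i)) =
  sp_coord (lshift m i) v.
Proof.
rewrite formB_coord (bigD1 i) //= big1 => [|j ji]; rewrite sp_coord_basis.
  by rewrite eqxx mulr1 addr0.
by rewrite (inj_eq (@rshift_inj _ _)) eq_sym (negbTE ji) mulr0.
Qed.

Lemma formB_rbasis0 (v : W) i : formB (tnth (sp_basis W) (rshift m i)) v = 0.
Proof.
rewrite formB_coord big1 // => j _; rewrite sp_coord_basis.
by rewrite eq_rlshift mul0r.
Qed.

Lemma formB_lbasis (v : W) i : formB (tnth (sp_basis W) (lshift m i)) v =
  sp_coord (rshift m i) v.
Proof.
rewrite formB_coord (bigD1 i) //= big1 => [|j ji]; rewrite sp_coord_basis.
  by rewrite eqxx mul1r addr0.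
by rewrite (inj_eq (@lshift_inj _ _)) eq_sym (negbTE ji) mul0r.
Qed.

Lemma formB_lbasis0 (v : W) i : formB v (tnth (sp_basis W) (lshift m i)) = 0.
Proof.
rewrite formB_coord big1 // => j _; rewrite sp_coord_basis.
by rewrite eq_lrshift mulr0.
Qed.

Definition X_part (w : W) : W :=
  \sum_i sp_coord (lshift m i) w *: tnth (sp_basis W) (lshift m i).
Definition Xs_part (w : W) : W :=
  \sum_i sp_coord (rshift m i) w *: tnth (sp_basis W) (rshift m i).

Lemma X_partE w : w = X_part w + Xs_part w.
Proof. by rewrite [LHS]sp_coordE big_split_ord. Qed.

Lemma formB_X_part (y w : W) : formB y (X_part w) = 0.
Proof.
by rewrite formB_sumr big1 // => i _; rewrite formBZr formB_lbasis0 mulr0.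
Qed.

Lemma formB_Xs_part (y w : W) : formB y (Xs_part w) = formB y w.
Proof. by rewrite [in RHS](X_partE w) formBDr formB_X_part add0r. Qed.
End Coordinates.

Section LatticeCoordinates.
Variables (R : realType) (Q : Q2_field R) (d : nat) (K : unramified_ext Q d).
Variables (m : nat) (W : symplectic_space K m).
Let absK := ue_absP K.

Lemma lat_halfP (w : W) :
  reflect (forall i, ue_abs (sp_coord i w) <= 1) (w \in lat_half W).
Proof.
apply: (iffP (asboolP _)) => [[a ->] i|h].
  by rewrite sp_coord_sum; exact: (valP (a i)).
exists (fun i => @IntElt _ _ _ K (sp_coord i w) (h i)).
exact: sp_coordE.
Qed.

Lemma lat_L'P (w : W) :
  reflect ((forall i, ue_abs (sp_coord (lshift m i) w) <= 2^-1) /\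
           (forall i, ue_abs (sp_coord (rshift m i) w) <= 1))
    (w \in lat_L' W).
Proof.
have tl i : tnth [tuple of map_tuple ( *:%R 2) (sp_e W) ++ sp_es W] (lshift m i) =
    2 *: tnth (sp_basis W) (lshift m i).
  by rewrite !tnth_lshift tnth_map.
have tr i : tnth [tuple of map_tuple ( *:%R 2) (sp_e W) ++ sp_es W] (rshift m i) =
    tnth (sp_basis W) (rshift m i).
  by rewrite !tnth_rshift.
(* The generators of L' are g i times the vectors of the symplectic basis. *)
pose g (i : 'I_(m + m)) : K := if fintype.split i is inl _ then 2 else 1.
have tE i : tnth [tuple of map_tuple ( *:%R 2) (sp_e W) ++ sp_es W] i =
    g i *: tnth (sp_basis W) i.
  rewrite /g -{1 3}(splitK i); case: (fintype.split i) => j; rewrite /unsplit ?tl //.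
  by rewrite tr scale1r.
have gl i : g (lshift m i) = 2 by rewrite /g (unsplitK (inl i)).
have gr i : g (rshift m i) = 1 by rewrite /g (unsplitK (inr i)).
apply: (iffP (asboolP _)) => [[a ->]|[h1 h2]].
  under eq_bigr do rewrite tE scalerA.
  split=> i; rewrite sp_coord_sum ?gl ?gr ?mulr1; last exact: (valP (a _)).
  by rewrite (absM absK) ue_abs2 ler_piMl ?invr_ge0 //; exact: (valP (a _)).
have h i : ue_abs (sp_coord i w / g i) <= 1.
  rewrite -(splitK i); case: (fintype.split i) => j; rewrite /unsplit ?gl ?gr ?divr1 //.
  by rewrite (absM absK) (uabsV absK) ue_abs2 invrK -ler_pdivlMr // div1r.
exists (fun i => @IntElt _ _ _ K (sp_coord i w / g i) (h i)).
rewrite [LHS]sp_coordE; apply: eq_bigr => i _ /=; rewrite tE scalerA divfK //.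
by rewrite /g; case: (fintype.split _) => _; rewrite ?oner_neq0 ?ue_two_neq0.
Qed.

Lemma lat_L'_half (w : W) : w \in lat_L' W -> w \in lat_half W.
Proof.
move=> /lat_L'P[h1 h2]; apply/lat_halfP => i.
rewrite -(splitK i); case: (fintype.split i) => j; rewrite /unsplit //.
by apply: le_trans (h1 _) _; rewrite invf_le1 // ler1n.
Qed.

Lemma double_half_L' (w : W) : 2^-1 *: w \in lat_half W -> w \in lat_L' W.
Proof.
move=> /lat_halfP h.
have {}h i : ue_abs (sp_coord i w) <= 2^-1.
  have := h i; rewrite sp_coordZ (absM absK) (uabsV absK) ue_abs2 invrK.
  by rewrite -ler_pdivlMl // mulr1.
apply/lat_L'P; split=> i //; apply: le_trans (h _) _.
by rewrite invf_le1 // ler1n.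
Qed.

Lemma basis_lat_half (a : int_type K) j : val a *: tnth (sp_basis W) j \in lat_half W.
Proof.
apply/lat_halfP => i; rewrite sp_coordZ sp_coord_basis.
case: eqP => _; rewrite ?mulr1 ?mulr0 ?(uabs0 absK) //; exact: (valP a).
Qed.

Lemma lat_L'D (u v : W) : u \in lat_L' W -> (u + v \in lat_L' W) = (v \in lat_L' W).
Proof. by move=> hu; exact: rpredDl. Qed.

Lemma lat_halfD (u v : W) :
  u \in lat_half W -> (v + u \in lat_half W) = (v \in lat_half W).
Proof. by move=> hu; exact: rpredDr. Qed.

Lemma lat_L'N (w : W) : (- w \in lat_L' W) = (w \in lat_L' W).
Proof. exact: rpredN. Qed.

Lemma Xs_part_L' (w : W) : w \in lat_half W -> Xs_part w \in lat_L' W.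
Proof.
move=> /lat_halfP hw.
have cE i : sp_coord i (Xs_part w) =
    \sum_j sp_coord (rshift m j) w * (rshift m j == i)%:R.
  rewrite /sp_coord linear_sum; apply: eq_bigr => j _.
  by rewrite linearZ /=; congr (_ * _); exact: sp_coord_basis.
apply/lat_L'P; split=> i; rewrite cE.
  by rewrite big1 ?(uabs0 absK) ?half_ge0 // => j _; rewrite eq_rlshift mulr0.
apply: (uabs_sum_le absK) => // j _.
by case: eqP => _; rewrite ?mulr1 ?mulr0 ?(uabs0 absK).
Qed.

Lemma X_part_half (w : W) : w \in lat_half W -> X_part w \in lat_half W.
Proof.
move=> hw; have -> : X_part w = w - Xs_part w by rewrite {2}(X_partE w) addrK.
by rewrite rpredB // lat_L'_half ?Xs_part_L'.
Qed.

End LatticeCoordinates.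

(** * Compactness of W_O *)

Section LatticeTopology.
Variables (R : realType) (Q : Q2_field R) (d : nat) (K : unramified_ext Q d).
Variables (m : nat) (W : symplectic_space K m).
Let absK := ue_absP K.

(** Convergence can be tested on coordinates: the subbase of the topology consists of
    cylinders, and by the ultrametric inequality an open ball is centered at each
    of its points. *)
Lemma cvg_sp_top (F : set_system (sp_top W)) (w : sp_top W) : Filter F ->
  (forall i (eps : R), 0 < eps ->
    F [set w' : sp_top W | ue_abs (sp_coord i (w' : W) - sp_coord i (w : W)) < eps]) ->
  F --> w.
Proof.
move=> FF h A; rewrite (@nbhsE (sp_top W)) => -[_ [[B sB <-] [C BC Cw] sUBA]].
apply: filterS sUBA _; apply: (@filterS _ _ _ C); first by move=> x Cx; exists C.
have /sB[D sD DC] := BC; rewrite -DC; apply: filter_bigI => E DE.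
have /sD := DE; rewrite in_setE => -[i [a [eps [eps0 EE]]]].
have wE : E w by move: Cw; rewrite -DC => /(_ _ DE).
apply: filterS (h i eps eps0) => w' /= hw'; rewrite EE /=.
move: wE; rewrite EE /= => wE.
rewrite -(subrK (sp_coord i w) (coord _ i _)) -addrA.
by apply: le_lt_trans (absD absK _ _) _; rewrite gt_max hw'.
Qed.

Lemma nbhs_ball (w : sp_top W) (eps : R) : 0 < eps ->
  \forall w' \near w, forall i, ue_abs (sp_coord i ((w' : W) - (w : W))) < eps.
Proof.
move=> eps0; pose f i (w' : sp_top W) :=
  ue_abs (sp_coord i ((w' : W) - (w : W))) < eps.
apply: (@filter_forall _ _ f (nbhs w)) => i.
pose C := [set w' : sp_top W |
  ue_abs (coord (sp_basis W) i w' - sp_coord i (w : W)) < eps].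
rewrite (@nbhsE (sp_top W)); exists C; last first.
  by move=> w'; rewrite /f sp_coordB.
split; last by rewrite /C /= subrr (uabs0 absK).
exists [set C]; last by rewrite bigcup_set1.
move=> _ ->; exists [fset C]%fset.
  by move=> E /fset1P ->; rewrite in_setE; exists i, (sp_coord i w), eps.
rewrite predeqE => x; split=> [h|Cx E /fset1P -> //].
exact: (h C (fset11 C)).
Qed.

(** L' is an open subgroup, so that L'-covariant functions supported on W_O are
    locally constant. *)
Lemma near_L' (w : sp_top W) : \forall w' \near w, (w' : W) - (w : W) \in lat_L' W.
Proof.
have h0 : (0 : R) < 2^-1 by rewrite invr_gt0.
have := nbhs_ball w h0; apply: filterS => w' h.
apply/lat_L'P; split=> i; apply: le_trans (ltW (h _)) _ => //.
by rewrite invf_le1 // ler1n.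
Qed.

Lemma lat_half_closed : closed [set w : sp_top W | w \in lat_half W].
Proof.
move=> w clw; have [w' [w'h hw']] := clw _ (near_L' w).
by rewrite /= -[w](subKr w') rpredB // lat_L'_half.
Qed.

(** W_O is a closed part of the image, under the continuous map that sums binary
    expansions, of a product of two-point spaces, which is compact by Tychonoff's
    theorem. *)
Lemma lat_half_compact : compact [set w : sp_top W | w \in lat_half W].
Proof.
have [n [u [u1 hu]]] := residue_generators K.
have digits := digit_expansion hu.
have [c hc] := binary_series Q.
(* The digits of weight 2^k of the coefficient of u i in the coordinate j are
   indexed by (k, (j, i)). *)
pose T := prod_topology (fun _ : nat * ('I_(m + m) * 'I_n) => bool).
pose x (a : T) j : K := \sum_i c (fun k => a (k, (j, i))) *: u i.
pose phi (a : T) : sp_top W := \sum_j x a j *: tnth (sp_basis W) j.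
have cT : compact [set: T].
  have := @tychonoff (nat * ('I_(m + m) * 'I_n))%type (fun=> bool)
    (fun=> [set: bool]) (fun=> bool_compact).
  by congr compact; apply/seteqP; split.
have phi_cont : continuous phi.
  move=> a; apply: cvg_sp_top => i eps eps0.
  have [N hN] := half_exp_small eps0.
  (* The first N digits determine the coordinate up to 2^-N. *)
  have : \forall a' \near a, forall (k : 'I_N) (l : 'I_n),
      a' (k : nat, (i, l)) = a (k : nat, (i, l)).
    pose f (p : 'I_N * 'I_n) (a' : T) :=
      a' (p.1 : nat, (i, p.2)) = a (p.1 : nat, (i, p.2)).
    have : \forall a' \near a, forall p, f p a'.
      apply: (@filter_forall _ _ f (nbhs a) _) => p.
      have /(_ [set a (p.1 : nat, (i, p.2))]) :=
        @proj_continuous _ (fun _ : nat * ('I_(m + m) * 'I_n) => bool)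
          (p.1 : nat, (i, p.2)) a.
      by apply; exact: discrete_set1.
    by apply: filterS => a' ha' k l; exact: (ha' (k, l)).
  apply: filterS => a' ha' /=.
  rewrite !sp_coord_sum; apply: le_lt_trans hN.
  rewrite /x -sumrB; apply: (uabs_sum_le absK) => [|l _].
    by rewrite exprn_ge0 ?half_ge0.
  rewrite -scalerBl ue_absZ -[leRHS]mulr1 ler_pM ?(abs_ge0 absK) ?(abs_ge0 (Q2_absP Q)) //.
  rewrite -(subrK (\sum_(k < N) 2 ^+ k * (a (k : nat, (i, l)))%:R) (c _)) -addrA.
  apply: (uabsD_le (Q2_absP Q)); last first.
    by rewrite -opprB (uabsN (Q2_absP Q)); exact: hc.
  have := hc (fun k => a' (k, (i, l))) N.
  by under eq_bigr do rewrite ha'.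
apply: (@subclosed_compact _ _ (phi @` setT)).
- exact: lat_half_closed.
- by apply: continuous_compact cT; exact: continuous_subspaceT.
move=> w /lat_halfP hw.
have /choice[b hb] i := digits _ (hw i).
exists (fun p => b p.2.1 p.2.2 p.1) => //.
rewrite /phi [RHS]sp_coordE; apply: eq_bigr => j _; congr (_ *: _).
apply/eqP; rewrite -subr_eq0; apply/eqP/(abs_eq0 absK)/eqP.
rewrite eq_le (abs_ge0 absK) andbT leNgt; apply/negP => /half_exp_small[N].
rewrite ltNge => /negP; apply.
pose y := \sum_i (\sum_(k < N) 2 ^+ k * (b j i k)%:R : Q) *: u i.
rewrite -(subrK y (x _ _)) -addrA; apply: (uabsD_le absK); last first.
  by rewrite -opprB (uabsN absK); exact: hb.
rewrite /x /y -sumrB; apply: (uabs_sum_le absK) => [|l _].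
  by rewrite exprn_ge0 ?half_ge0.
rewrite -scalerBl ue_absZ -[leRHS]mulr1.
by rewrite ler_pM ?(abs_ge0 absK) ?(abs_ge0 (Q2_absP Q)) //; exact: hc.
Qed.
End LatticeTopology.

(** * The finite symplectic space W and the character psi *)

Section ResidualSpace.
Variables (R : realType) (Q : Q2_field R) (d : nat) (K : unramified_ext Q d).
Variables (m : nat) (W : symplectic_space K m).
Let absK := ue_absP K.

Lemma resW_finite : exists2 s : seq (resW W), uniq s & forall a, a \in s.
Proof.
have [n [u [u1 hu]]] := residue_generators K.
pose x (a : {ffun 'I_(m + m) * 'I_n -> bool}) : W :=
  \sum_j (\sum_i (a (j, i))%:R * u i) *: tnth (sp_basis W) j.
have xO a : x a \in lat_half W.
  apply/lat_halfP => j; rewrite sp_coord_sum.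
  apply: (uabs_sum_le absK) => // i _.
  by case: (a _); rewrite ?mul1r ?mul0r ?(uabs0 absK).
exists (undup [seq to_resW (LatO (xO a)) | a : {ffun 'I_(m + m) * 'I_n -> bool}]).
  exact: undup_uniq.
move=> w; rewrite mem_undup -(to_resWK w); set v := repr w.
have /lat_halfP hv := valP v.
have /choice[b hb] j := hu _ (hv j).
apply/mapP; exists [ffun p => b p.1 p.2]; first by rewrite mem_enum.
apply/eqP; rewrite to_resW_eq; apply/lat_halfP => j.
have -> : val (v - LatO (xO [ffun p => b p.1 p.2])) =
    val v - x [ffun p => b p.1 p.2] by exact: (raddfB val).
rewrite sp_coordZ sp_coordB sp_coord_sum (absM absK) (uabsV absK) ue_abs2 invrK.
rewrite -ler_pdivlMl // mulr1.
by under [X in _ - X]eq_bigr do rewrite ffunE; exact: hb.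
Qed.

Variables (Psi : K -> R[i]) (Psi_char : is_character Psi)
  (Psi_level : level_m2 Psi) (psi_faithful : faithful_char (res_char Psi)).
Let PsiD : {morph Psi : x y / x + y >-> x * y} := Psi_char.2.

Lemma res_char0 : res_char Psi 0 = 1.
Proof.
have -> : 0 = to_res 0 :> res_ring K by rewrite /to_res rmorph0.
by rewrite res_charE // raddf0 Psi_char.1.
Qed.

Lemma res_charD : {morph res_char Psi : x y / x + y >-> x * y}.
Proof.
move=> x y; rewrite -(to_resK x) -(to_resK y) -to_resD !res_charE //.
by rewrite raddfD PsiD.
Qed.

(** If x is integral but not in 2O, then 2x is nonzero in O / 4O, so by faithfulness the
    ideal it generates is not in the kernel of psi. *)
Lemma faithful_detects (x : K) : ue_abs x <= 1 -> ~~ (ue_abs x <= 2^-1) ->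
  exists s : int_type K, Psi (2 * (val s * x)) != 1.
Proof.
move=> x1 x2; pose X : int_type K := @IntElt _ _ _ K x x1.
have : to_res (2 * X) != to_res 0.
  rewrite to_res_eq subr0; apply: contra x2 => h.
  have {}h : ue_abs (2 * x / 2 ^+ 2) <= 1 by exact: h.
  move: h; rewrite !(absM absK) (uabsV absK) (uabsX absK) !ue_abs2 => h.
  lra.
apply: contraNP => /forallNP h; have -> : to_res 0 = 0 :> res_ring K.
  by rewrite /to_res rmorph0.
apply/eqP/psi_faithful => r; rewrite -(to_resK r) -[_ * to_res _]rmorphM.
rewrite [X in res_char _ X](_ : _ = to_res (repr r * (2 * X))) //.
rewrite res_charE //; have := h (repr r); move/negP; rewrite negbK => /eqP <-.
congr Psi; rewrite (rmorphM val) (rmorphM val) (rmorph_nat val).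
exact: mulrCA.
Qed.

Lemma res_char_beta (u v : latO W) :
  res_char Psi (beta (to_resW u) (to_resW v)) = Psi (formB' (val u) (val v)).
Proof. by rewrite betaE res_charE // val_formB'O. Qed.

(** Some coordinate of w is not in 2O. Pairing w with multiples of the dual basis
    vector isolates that coordinate, because B is nonzero on only one of the two
    orders of the arguments. *)
Lemma beta_nondegenerate (w : resW W) : w != 0 ->
  exists u, res_char Psi (beta u w - beta w u) != 1.
Proof.
have to0 : to_resW 0 = 0 :> resW W by rewrite /to_resW raddf0.
rewrite -{1}(to_resWK w) -to0 to_resW_eq subr0; set v := repr w => hv.
have psiE u : res_char Psi (beta (to_resW u) w - beta w (to_resW u)) =
    Psi (formB' (val u) (val v) - formB' (val v) (val u)).
  rewrite -(to_resWK w) -/v !betaE.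
  have <- : to_res (formB'O u v - formB'O v u) =
      to_res (formB'O u v) - to_res (formB'O v u) by exact: raddfB.
  by rewrite res_charE // (raddfB val) !val_formB'O.
have [j hj] : exists j, ~~ (ue_abs (sp_coord j (val v)) <= 2^-1).
  apply: contrapT => /forallNP h; case/negP: hv; apply/lat_halfP => j.
  rewrite sp_coordZ (absM absK) (uabsV absK) ue_abs2 invrK.
  by rewrite -ler_pdivlMl // mulr1; have /negP := h j; rewrite negbK.
have vj : ue_abs (sp_coord j (val v)) <= 1 by have /lat_halfP := valP v.
have [s hs] := faithful_detects vj hj.
case: (split_ordP j) hs => i -> hs.
  (* Here the pairing is - beta(w, u), whence the sign in the choice of u. *)
  exists (to_resW (- LatO (basis_lat_half W s (rshift m i)))).
  rewrite psiE (raddfN val) /= /formB' formBNl formBNr formBZl formBZr.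
  by rewrite formB_rbasis formB_rbasis0 mulr0 oppr0 mulr0 sub0r mulrN opprK.
exists (to_resW (LatO (basis_lat_half W s (lshift m i)))).
rewrite psiE /= /formB' formBZl formBZr.
by rewrite formB_lbasis formB_lbasis0 !mulr0 subr0.
Qed.
End ResidualSpace.

(** * The action of H_beta(W) on V_psi *)

Section LatticeModel.
Variables (R : realType) (Q : Q2_field R) (d : nat) (K : unramified_ext Q d).
Variables (m : nat) (W : symplectic_space K m).
Let absK := ue_absP K.
Variables (Psi : K -> R[i]) (Psi_char : is_character Psi)
  (Psi_level : level_m2 Psi).
Let PsiD : {morph Psi : x y / x + y >-> x * y} := Psi_char.2.

Lemma Psi_quarter x : ue_abs x <= 2^-1 ^+ 2 -> Psi x = 1.
Proof.
move=> h; apply: Psi_level.1; change (ue_abs (x / 2 ^+ 2) <= 1).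
rewrite (absM absK) (uabsV absK) (uabsX absK) ue_abs2 ler_pdivrMr ?mul1r //.
by rewrite exprn_gt0 // invr_gt0.
Qed.

Lemma Psi_L'_half (l w : W) : l \in lat_L' W -> w \in lat_half W ->
  Psi (- formB' l w) = 1.
Proof.
move=> /lat_L'P[hl _] /lat_halfP hw; apply: Psi_quarter.
rewrite (uabsN absK) (absM absK) ue_abs2 expr2 ler_wpM2l ?half_ge0 //.
rewrite formB_coord (uabs_sum_le absK) ?half_ge0 // => i _.
by rewrite (absM absK) -[leRHS]mulr1 ler_pM ?(abs_ge0 absK).
Qed.

(** Local constancy holds because L' is open and Psi(B'(L', W_O)) = 1; compactness of
    the support holds because W_O is compact. *)
Lemma V_psi_predP (f : fct W) :
  reflect ((forall w, w \notin lat_half W -> f w = 0) /\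
    (forall l w, l \in lat_L' W -> f (l + w) = Psi (- formB' l w) * f w))
    (f \in V_psi_pred Psi).
Proof.
apply: (iffP (asboolP _)) => [[[_ _ cov] supp]|[supp cov]].
  by split=> // w; apply: contraNeq; exact: supp.
have supp' w : f w != 0 -> w \in lat_half W.
  by apply: contraNT => /supp ->.
split=> //; split=> // [w|].
  have := near_L' w; apply: filterS => w' hw'.
  rewrite -[w' in LHS](subrK (w : W)) cov //.
  have [wO|/supp ->] := boolP ((w : W) \in lat_half W); last by rewrite mulr0.
  by rewrite Psi_L'_half // mul1r.
apply: (@subclosed_compact (sp_top W) _ [set w : sp_top W | w \in lat_half W]).
- exact: closed_closure.
- exact: lat_half_compact.
rewrite [X in _ `<=` X](closure_id _).1; last exact: lat_half_closed.
by apply: closure_subset => w; exact: supp'.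
Qed.

Lemma V_psi_supp (f : V_psi W Psi) w : w \notin lat_half W -> V_psi_val f w = 0.
Proof. by have /V_psi_predP[+ _] := valP f; apply. Qed.

Lemma V_psi_cov (f : V_psi W Psi) l w : l \in lat_L' W ->
  V_psi_val f (l + w) = Psi (- formB' l w) * V_psi_val f w.
Proof. by have /V_psi_predP[_] := valP f; apply. Qed.

Lemma V_psi_invar (f : V_psi W Psi) l w :
  l \in lat_L' W -> V_psi_val f (l + w) = V_psi_val f w.
Proof.
move=> hl; rewrite V_psi_cov //.
have [wO|/V_psi_supp ->] := boolP (w \in lat_half W); last by rewrite mulr0.
by rewrite Psi_L'_half // mul1r.
Qed.

Lemma Pi'_stable (h : HB'_O W) (f : V_psi W Psi) :
  Pi'_Psi Psi (HB'_incl h) (V_psi_val f) \in V_psi_pred Psi.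
Proof.
case: h => u t; apply/V_psi_predP; rewrite /Pi'_Psi /=; split=> [w wO|l w hl].
  by rewrite V_psi_supp ?mulr0 // lat_halfD // (valP u).
rewrite -[l + w + _]addrA (V_psi_cov _ _ hl) formB'Dr formB'Dl opprD.
by rewrite !mulrA -!PsiD; congr (Psi _ * _); ring.
Qed.

Lemma Pi'M (g h : HB' W) (f : fct W) :
  Pi'_Psi Psi (g * h)%g f = Pi'_Psi Psi g (Pi'_Psi Psi h f).
Proof.
apply/funext => w; case: g h => [u r] [v s]; rewrite /Pi'_Psi /=.
rewrite mulrA -PsiD addrA; congr (Psi _ * _).
by rewrite formB'Dr formB'Dl; ring.
Qed.

(** The lattice 2 W_O lies in L', and B'(W_O, 2 W_O) lies in m^2. *)
Lemma Pi'_trivial (h : HB'_O W) (f : V_psi W Psi) : h \in @HB'_m _ _ _ _ _ W ->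
  Pi'_Psi Psi (HB'_incl h) (V_psi_val f) = V_psi_val f.
Proof.
case: h => u t /andP[/= hu ht]; apply/funext => w; rewrite /Pi'_Psi /=.
have uL : val u \in lat_L' W by apply: double_half_L'; exact: hu.
rewrite addrC [w + _]addrC V_psi_invar // PsiD (Psi_level.1 (val t)) // mulr1.
have [wO|/V_psi_supp ->] := boolP (w \in lat_half W); last by rewrite mulr0.
rewrite Psi_quarter ?mul1r // (absM absK) ue_abs2 expr2 ler_wpM2l ?half_ge0 //.
rewrite formB_coord (uabs_sum_le absK) ?half_ge0 // => i _.
move/lat_halfP: wO => wO; move/lat_halfP: hu => hu.
have := hu (rshift m i); rewrite sp_coordZ (absM absK) (uabsV absK) ue_abs2 invrK.
rewrite -ler_pdivlMl // mulr1 => hui.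
by rewrite (absM absK) -[leRHS]mul1r ler_pM ?(abs_ge0 absK).
Qed.

Definition quotient_lift (x : Hbeta W) : HB'_O W :=
  Heis (repr (heis_w x)) (repr (heis_t x)).

Definition lattice_action (x : Hbeta W) (f : V_psi W Psi) : V_psi W Psi :=
  VPsi (Pi'_stable (quotient_lift x) f).

Lemma lattice_action_linear x : linear (lattice_action x).
Proof.
move=> a f g; apply: val_inj; apply/funext => w.
change (Pi'_Psi Psi (HB'_incl (quotient_lift x)) (V_psi_val (a *: f + g)) w =
  a * Pi'_Psi Psi (HB'_incl (quotient_lift x)) (V_psi_val f) w +
  Pi'_Psi Psi (HB'_incl (quotient_lift x)) (V_psi_val g) w).
by rewrite /Pi'_Psi mulrCA -mulrDr.
Qed.

HB.instance Definition _ x :=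
  GRing.isLinear.Build R[i] (V_psi W Psi) (V_psi W Psi) *:%R
    (lattice_action x) (lattice_action_linear x).

(** The lift chosen in the definition of the action does not matter, as two lifts
    differ by an element of H_B'(W_m). *)
Lemma lattice_action_red (h : HB'_O W) (f : V_psi W Psi) :
  V_psi_val (lattice_action (HB'_red h) f) = Pi'_Psi Psi (HB'_incl h) (V_psi_val f).
Proof.
rewrite /=; set h' := quotient_lift _.
have red_h' : HB'_red h' = HB'_red h by apply: heis_eq; rewrite /= ?to_resWK ?to_resK.
have k1 : (h'^-1 * h)%g \in @HB'_m _ _ _ _ _ W.
  rewrite -HB'_red_ker; apply/eqP; apply: (mulgI (HB'_red h')).
  by rewrite -HB'_redM mulgA mulgV mul1g mulg1.
rewrite -[h in RHS](mul1g h) -(mulgV h') -mulgA HB'_inclM Pi'M.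
by rewrite (Pi'_trivial f k1).
Qed.

Lemma lattice_action1 f : lattice_action 1%g f = f.
Proof.
have -> : (1%g : Hbeta W) = HB'_red 1%g.
  by apply/esym/eqP; rewrite HB'_red_ker; apply/andP; split; exact: rpred0.
apply: val_inj; rewrite [LHS]lattice_action_red; apply/funext => w.
rewrite /Pi'_Psi /= addr0 add0r /formB'.
by rewrite -(scale0r 0) formBZr mul0r mulr0 Psi_char.1 mul1r.
Qed.

Lemma lattice_actionM g h f :
  lattice_action (g * h)%g f = lattice_action g (lattice_action h f).
Proof.
have [g' <-] := HB'_red_surj g; have [h' <-] := HB'_red_surj h.
apply: val_inj.
rewrite -HB'_redM [LHS]lattice_action_red [RHS]lattice_action_red lattice_action_red.
by rewrite HB'_inclM Pi'M.
Qed.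

Definition lattice_rep : representation (Hbeta W) (V_psi W Psi) :=
  @Representation _ _ _ (fun x => lattice_action x) lattice_action1 lattice_actionM.

End LatticeModel.

(** * Irreducibility of V_psi *)

Section SubmodClosed.
Variables (F : fieldType) (V : lmodType F) (U : {pred V}).
Hypothesis Uc : submod_closed U.

Lemma submod_closed_scale a v : v \in U -> a *: v \in U.
Proof. by move=> hv; rewrite -[_ *: _]addr0; apply: Uc.2 => //; exact: Uc.1. Qed.

Lemma submod_closed_sum (I : Type) (r : seq I) (f : I -> V) :
  (forall i, f i \in U) -> \sum_(i <- r) f i \in U.
Proof.
move=> h; elim/big_ind: _ => [|x y hx hy|//]; first exact: Uc.1.
by rewrite -[x]scale1r; exact: Uc.2.
Qed.
End SubmodClosed.

Section Irreducibility.
Variables (R : realType) (Q : Q2_field R) (d : nat) (K : unramified_ext Q d).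
Variables (m : nat) (W : symplectic_space K m).
Let absK := ue_absP K.
Variables (Psi : K -> R[i]) (Psi_char : is_character Psi)
  (Psi_level : level_m2 Psi) (psi_faithful : faithful_char (res_char Psi)).
Local Notation V := (V_psi W Psi).
Local Notation rho := (@lattice_rep _ _ _ _ _ W _ Psi_char Psi_level).

Definition eval_at (y : W) (f : V) : R[i]^o := V_psi_val f y.

Lemma eval_at_linear y : linear (eval_at y). Proof. by []. Qed.
HB.instance Definition _ y :=
  GRing.isLinear.Build R[i] V R[i]^o *:%R (eval_at y) (eval_at_linear y).

Lemma eval_at_inj (f g : V) : (forall y, eval_at y f = eval_at y g) -> f = g.
Proof. by move=> h; apply: val_inj; apply/funext; exact: h. Qed.

Lemma eval_at_rho y (u : latO W) (f : V) :
  eval_at y (rho (Heis (to_resW u) 0) f) = Psi (formB' y (val u)) * eval_at (y + val u) f.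
Proof.
have -> : Heis (to_resW u) 0 = HB'_red (Heis u 0) :> Hbeta W.
  by apply: heis_eq => //=; rewrite /to_res raddf0.
rewrite /eval_at [V_psi_val _](lattice_action_red Psi_char Psi_level) /Pi'_Psi /=.
by rewrite add0r.
Qed.

Lemma lattice_rep_central : has_central_char (res_char Psi) rho.
Proof.
move=> t f; apply: eval_at_inj => y.
have -> : Heis 0 t = HB'_red (Heis 0 (repr t)) :> Hbeta W.
  by apply: heis_eq; rewrite /= ?to_resK // /to_resW raddf0.
rewrite /eval_at [V_psi_val (rho _ _)](lattice_action_red Psi_char Psi_level) /Pi'_Psi /=.
have -> : formB' y 0 = 0 by rewrite /formB' -(scale0r 0) formBZr mul0r mulr0.
by rewrite !addr0.
Qed.

Definition delta_fct : fct W := fun w => (w \in lat_L' W)%:R.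

Lemma delta_subproof : delta_fct \in V_psi_pred Psi.
Proof.
apply/(V_psi_predP Psi_level); rewrite /delta_fct; split=> [w|l w hl].
  by have [/lat_L'_half ->|] := boolP (w \in lat_L' W).
rewrite lat_L'D //; have [hw|] := boolP (w \in lat_L' W); last by rewrite mulr0.
by rewrite Psi_L'_half ?mul1r // lat_L'_half.
Qed.

Definition delta : V := VPsi delta_subproof.

Lemma eval_at_delta0 : eval_at 0 delta = 1.
Proof.
rewrite [LHS]/(delta_fct 0) /delta_fct (_ : 0 \in lat_L' W) //.
by apply: double_half_L'; rewrite scaler0; exact: rpred0.
Qed.

Variable s : seq (resW W).
Hypotheses (s_uniq : uniq s) (s_full : forall a, a \in s).

Lemma size_s_neq0 : (size s)%:R != 0 :> R[i].
Proof.
rewrite pnatr_eq0; apply/eqP => /size0nil s0.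
by have := s_full 0; rewrite s0.
Qed.

(** Orthogonality of characters: for y outside L', some multiple of a vector of the
    basis of X^* shows that u |-> psi(beta(y, u)) is a nontrivial character. *)
Lemma sum_Psi (y : W) : y \in lat_half W ->
  \sum_(a <- s) Psi (formB' y (val (repr a))) =
    (size s)%:R * (y \in lat_L' W)%:R.
Proof.
move=> hy; have /lat_halfP y1 := hy; pose Y := LatO hy.
have psiE a : Psi (formB' y (val (repr a))) = res_char Psi (beta (to_resW Y) a).
  by rewrite -{2}(to_resWK a) res_char_beta.
have [yL|yL] := boolP (y \in lat_L' W).
  rewrite mulr1 (eq_bigr (fun=> 1)) => [|a _].
    by rewrite big_const_seq count_predT iter_addr_0.
  have -> : formB' y (val (repr a)) = - formB' (- y) (val (repr a)).
    by rewrite /formB' formBNl mulrN opprK.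
  by rewrite Psi_L'_half ?(valP (repr a)) // lat_L'N.
rewrite mulr0; under eq_bigr do rewrite psiE.
have [i hi] : exists i, ~~ (ue_abs (sp_coord (lshift m i) y) <= 2^-1).
  apply: contrapT => /forallNP h; case/negP: yL; apply/lat_L'P; split=> i.
    by have /negP := h i; rewrite negbK.
  exact: y1.
have [c hc] := faithful_detects Psi_char Psi_level psi_faithful (y1 _) hi.
apply: (character_sum0 s_uniq s_full
  (a := to_resW (LatO (basis_lat_half W c (rshift m i))))).
  by move=> u v; rewrite betaDr (res_charD Psi_char Psi_level).
by rewrite res_char_beta //= /formB' formBZr formB_rbasis.
Qed.

Lemma eval_at_sum y (F : resW W -> V) :
  eval_at y (\sum_(a <- s) F a) = \sum_(a <- s) eval_at y (F a).
Proof. exact: linear_sum. Qed.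

Lemma eval_atZ y c f : eval_at y (c *: f) = c * eval_at y f.
Proof. exact: linearZ. Qed.

(** The elements of X^* (and below of X) indexed by all of W, through the projections of
    representatives: sums over W then serve as sums over X^* or X, up to a
    constant factor. *)
Definition Xs_elt (a : resW W) : Hbeta W :=
  Heis (to_resW (LatO (lat_L'_half (Xs_part_L' (valP (repr a)))))) 0.

Definition X_elt (a : resW W) : Hbeta W :=
  Heis (to_resW (- LatO (X_part_half (valP (repr a))))) 0.

(** An element u of X^* multiplies f by y |-> Psi(B'(y, u)), and B'(y, a) only depends
    on the component of a in X^*; the sum of these characters is supported on L',
    where f is constant. *)
Lemma sum_Xs_elt (f : V) :
  \sum_(a <- s) rho (Xs_elt a) f = ((size s)%:R * eval_at 0 f) *: delta.
Proof.
apply: eval_at_inj => y; rewrite eval_at_sum eval_atZ.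
transitivity (\sum_(a <- s) Psi (formB' y (val (repr a))) * eval_at y f).
  apply: eq_bigr => a _; rewrite /Xs_elt eval_at_rho /= {1}/formB' formB_Xs_part.
  by rewrite -/(formB' _ _) /eval_at addrC V_psi_invar // Xs_part_L' ?(valP (repr a)).
rewrite -mulr_suml; have [hy|hy] := boolP (y \in lat_half W).
  rewrite sum_Psi // -!mulrA; congr (_ * _); rewrite mulrC.
  rewrite [eval_at y delta]/(delta_fct y) /delta_fct.
  have [yL|_] := boolP (y \in lat_L' W); last by rewrite !mulr0.
  by rewrite -[in LHS](addr0 y) {1}/eval_at V_psi_invar.
by rewrite /eval_at !(V_psi_supp Psi_level _ hy) !mulr0.
Qed.

(** The index of W_m in L', which is the number of classes of W whose component in X
    vanishes. *)
Definition L'_index : R[i] :=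
  \sum_(a <- s) (val (repr (- a)) \in lat_L' W)%:R.

Lemma L'_index_neq0 : L'_index != 0.
Proof.
rewrite /L'_index -natr_sum pnatr_eq0 (bigD1_seq 0) //= oppr0.
suff -> : val (repr (0 : resW W)) \in lat_L' W by [].
apply: double_half_L'; rewrite -[repr _]subr0 -to_resW_eq to_resWK.
by rewrite /to_resW raddf0.
Qed.

(** The value at y of the translate of delta by a is 1 if y - a is in L', and then
    f(a) = f(y); the number of such a does not depend on y. *)
Lemma sum_X_elt (f : V) :
  \sum_(a <- s) eval_at (val (repr a)) f *: rho (X_elt a) delta = L'_index *: f.
Proof.
apply: eval_at_inj => y; rewrite eval_at_sum eval_atZ.
have [hy|hy] := boolP (y \in lat_half W); last first.
  rewrite [eval_at y f]V_psi_supp // mulr0 big1 // => a _.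
  by rewrite eval_atZ [eval_at y _]V_psi_supp ?mulr0.
pose Y := LatO hy.
have -> : L'_index = \sum_(a <- s) (val (repr (to_resW Y - a)) \in lat_L' W)%:R.
  rewrite /L'_index -[LHS](sum_translate s_uniq s_full _ (- to_resW Y)).
  by apply: eq_bigr => a _; rewrite opprB.
rewrite mulr_suml; apply: eq_bigr => a _; rewrite eval_atZ /X_elt eval_at_rho /=.
rewrite {1}/formB' formBNr formB_X_part oppr0 mulr0 Psi_char.1 mul1r.
rewrite /delta_fct.
have -> : (y - X_part (val (repr a)) \in lat_L' W) = (y - val (repr a) \in lat_L' W).
  have hL : - Xs_part (val (repr a)) \in lat_L' W.
    by rewrite lat_L'N Xs_part_L' ?(valP (repr a)).
  rewrite {2}(X_partE (val (repr a))) opprD addrA [in RHS]addrC.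
  by rewrite [RHS](lat_L'D _ hL).
have -> : (val (repr (to_resW Y - a)) \in lat_L' W) = (y - val (repr a) \in lat_L' W).
  set z := repr _.
  have zE : val z - (y - val (repr a)) \in lat_L' W.
    apply: double_half_L'.
    have -> : val z - (y - val (repr a)) = val (z - (Y - repr a)).
      by rewrite !(raddfB val).
    rewrite -to_resW_eq to_resWK; apply/eqP.
    have -> : to_resW (Y - repr a) = to_resW Y - to_resW (repr a) by exact: raddfB.
    by rewrite to_resWK.
  by rewrite -[val z](subrK (y - val (repr a))) (lat_L'D _ zE).
have [h|_] := boolP (y - val (repr a) \in lat_L' W); last by rewrite mulr0 mul0r.
by rewrite mulr1 mul1r -[y in RHS](subrK (val (repr a))) /eval_at V_psi_invar.
Qed.

Lemma lattice_rep_irreducible : irreducible_rep rho.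
Proof.
split.
  exists delta; apply/eqP => /(congr1 (eval_at 0))/eqP.
  by rewrite eval_at_delta0 linear0 oner_eq0.
move=> U Uc Us; have [hU|] := pselect (forall v, v \in U -> v = 0); first by left.
move=> /existsNP[f /not_implyP[fU f0]]; right=> g.
have [y0 fy0] : exists y, eval_at y f != 0.
  apply: contrapT => /forallNP h; apply: f0; apply: eval_at_inj => y.
  by rewrite linear0; have /negP := h y; rewrite negbK => /eqP.
have y0O : y0 \in lat_half W by apply: contraNT fy0 => /V_psi_supp h; apply/eqP/h.
pose f' := rho (Heis (to_resW (LatO y0O)) 0) f.
have f'0 : eval_at 0 f' != 0.
  rewrite /f' eval_at_rho /= add0r mulf_neq0 // /formB' -(scale0r 0) formBZl mul0r mulr0.
  by rewrite Psi_char.1 oner_neq0.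
have dU : delta \in U.
  have c0 := mulf_neq0 size_s_neq0 f'0.
  rewrite -[delta](scalerK c0) -sum_Xs_elt; apply: submod_closed_scale => //.
  by apply: submod_closed_sum => // a; exact: (Us _ _ (Us _ _ fU)).
rewrite -[g](scalerK L'_index_neq0) -sum_X_elt; apply: submod_closed_scale => //.
by apply: submod_closed_sum => // a; apply: submod_closed_scale => //; exact: (Us _ _ dU).
Qed.

End Irreducibility.

Theorem corollary3p13 (R : realType) (Q : Q2_field R) (d : nat)
    (K : unramified_ext Q d) (m : nat) (W : symplectic_space K m)
    (Psi : K -> R[i]%C) (Psi_char : is_character Psi)
    (Psi_level : level_m2 Psi) (psi_faithful : faithful_char (res_char Psi)) :
  exists rho : representation (Hbeta W) (V_psi W Psi),
    (forall (h : HB'_O W) (f : V_psi W Psi),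
       V_psi_val (rho (HB'_red h) f) =
         Pi'_Psi Psi (HB'_incl h) (V_psi_val f)) /\
    is_Heisenberg_rep (res_char Psi) rho.
Proof.
have [s s_uniq s_full] := resW_finite W.
exists (lattice_rep W Psi_char Psi_level); split; first exact: lattice_action_red.
split; first exact: (lattice_rep_irreducible _ _ psi_faithful s_uniq s_full).
  exact: lattice_rep_central.
move=> V' rho' irr' cc'.
apply: (heis_rep_unique (res_char0 Psi_char Psi_level)
  (res_charD Psi_char Psi_level) _ s_uniq s_full
  (lattice_rep_irreducible _ _ psi_faithful s_uniq s_full) irr'
  (@lattice_rep_central _ _ _ _ _ _ _ _ _) cc'
  (lambda := eval_at 0) (v0 := delta W Psi_level)).
- exact: beta_nondegenerate.
- by have := oner_neq0 R[i]%C; rewrite -{1}(eval_at_delta0 W Psi_level).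
Qed.
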